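(* Let $H$ be a real separable infinite-dimensional Hilbert space, $\Psi$ a Hilbert–Schmidt operator on $H$ with Hilbert–Schmidt norm $\|\Psi\|_{\mathcal S(H,H)}<1$, and let $\{X_n\}_{n\ge1}$ be an ARH(1) process, i.e. the stationary process $X_n=\sum_{j\ge0}\Psi^j(\varepsilon_{n-j})$ satisfying $X_{n+1}=\Psi(X_n)+\varepsilon_{n+1}$. Put $Y_k=X_{k+1}$. Assume that the covariance operator $C=E[X_1\otimes X_1]$ has mutually distinct eigenvalues and $H=\overline{\mathrm{Im}(C)}$, that $\{\varepsilon_i\}$ is $H$-white noise, and that Assumption (A) (stated in the context) holds for the linear model $Y_k=\Psi(X_k)+\varepsilon_{k+1}$. Let $m_n\to\infty$ with $m_n^6=o(n)$ and $$K_n=\min(B_n,E_n,m_n),\qquad B_n=\max\{j\ge1:\hat\lambda_j^{-1}\le m_n\},\qquad E_n=\max\Big\{k\ge1:\max_{1\le j\le k}\hat\alpha_j^{-1}\le m_n\Big\}.$$ Then the estimator $\hat\Psi_{K_n}(x)=\sum_{j=1}^{K_n}\hat\lambda_j^{-1}\langle\hat v_j,x\rangle_H\hat\Delta(\hat v_j)$ is (weakly) consistent: $\|\hat\Psi_{K_n}-\Psi\|_{\mathcal L(H,H)}\to0$ in probability as $n\to\infty$.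
   Context: Notation: $\mathcal L(H,H)$ is the space of bounded linear operators on $H$ with operator norm. $(x\otimes y)(v)=\langle x,v\rangle y$. $X\in L^p_H$ means $\nu_{p,H}(X):=(E\|X\|_H^p)^{1/p}<\infty$. $X\perp Y$ means $E[X\otimes Y]=0$. $H$-white noise: a sequence of pairwise orthogonal elements of $L^2_H$ with constant mean and constant covariance operator. $L^p$–$m$–approximability: a sequence $\{X_n\}$ in $L^p_H$ is $L^p$–$m$–approximable if $X_n=f(\delta_n,\delta_{n-1},\dots)$ with $\delta_i$ ($i\in\mathbb Z$) i.i.d. in a measurable space $S$ and $f:S^\infty\to H$ measurable, and, with $\{\delta_i'\}$ an independent copy of $\{\delta_i\}$ and $X_n^{(m)}=f(\delta_n,\dots,\delta_{n-m+1},\delta'_{n-m},\delta'_{n-m-1},\dots)$, one has $\sum_{m\ge1}\nu_{p,H}(X_m-X_m^{(m)})<\infty$. Assumption (A) for the model $Y_k=\Psi(X_k)+e_k$, $k\ge1$ (here $e_k=\varepsilon_{k+1}$): $\Psi$ is bounded linear; $\{X_k\}$ and $\{e_k\}$ are zero mean and $L^4$–$m$–approximable, with representations $X_k=f(\delta_k,\delta_{k-1},\dots)$ and $e_k=g(\delta_k,\delta_{k-1},\dots)$ in terms of the same innovations $\{\delta_i\}$; $\{e_k\}$ is $H$-white noise; $X_k\perp e_k$ for every $k\ge1$. From $(X_1,Y_1),\dots,(X_n,Y_n)$ put $\hat C=\frac1n\sum_{k=1}^nX_k\otimes X_k$ and $\hat\Delta=\frac1n\sum_{k=1}^nX_k\otimes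 Y_k$. $\hat\lambda_1\ge\hat\lambda_2\ge\cdots\ge0$ are the eigenvalues of $\hat C$ (zero beyond its rank), $\hat v_j$ corresponding orthonormal eigenvectors, $\hat\alpha_1=\hat\lambda_1-\hat\lambda_2$ and $\hat\alpha_j=\min\{\hat\lambda_{j-1}-\hat\lambda_j,\hat\lambda_j-\hat\lambda_{j+1}\}$ for $j>1$. Conventions: $1/0=+\infty$, $\max\emptyset=0$, a non-integer minimum defining $K_n$ is rounded down, and empty sums are $0$. *)

(* Defs.v *)
From HB Require Import structures.
From mathcomp Require Import all_boot all_order all_algebra sesquilinear.
From mathcomp Require Import all_classical all_reals all_analysis.

Set Implicit Arguments.
Unset Strict Implicit.
Unset Printing Implicit Defensive.

Import Order.TTheory GRing.Theory Num.Theory.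
Import numFieldNormedType.Exports.

Local Open Scope classical_set_scope.
Local Open Scope ring_scope.

Section hilbert.
Context {R : realType} {H : completeNormedModType R}.

(* Together with completeness of H, this makes H a real Hilbert space. *)
Definition norm_from_inner (ip : {dot H for idfun}) : Prop :=
  forall x : H, `|x| ^+ 2 = ip x x.

Variable ip : {dot H for idfun}.

Definition orthonormal_sequence (e : nat -> H) : Prop :=
  forall i j, ip (e i) (e j) = (i == j)%:R.

Definition orthonormal_basis (e : nat -> H) : Prop :=
  orthonormal_sequence e /\
  closure [set x | exists (n : nat) (c : nat -> R), x = \sum_(i < n) c i *: e i]
    = [set: H].

Definition tensor (x y : H) : H -> H := fun v => ip x v *: y.

Definition op_norm (T : H -> H) : \bar R :=
  ereal_sup [set (`|T x|)%:E | x in [set x | `|x| <= 1]].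

(* The value does not depend on the orthonormal basis e. *)
Definition HS_norm (e : nat -> H) (T : H -> H) : \bar R :=
  poweR (\sum_(0 <= j <oo) (`|T (e j)| ^+ 2)%:E)%E 2^-1.

(* Eigen-elements of a compact, self-adjoint, nonnegative operator T, numbered
   from 1; the values at index 0 are irrelevant.  The last clause says that no
   nonzero eigenvalue has been left out, so that every nonzero eigenvalue
   occurs in lam as often as its multiplicity; if T has finite rank r, then
   lam j <> 0 for 1 <= j <= r and lam j = 0 for j > r. *)
Definition eigen_system (T : H -> H) (lam : nat -> R) (v : nat -> H) : Prop :=
  [/\ forall j, (1 <= j)%N -> lam j.+1 <= lam j /\ 0 <= lam j,
      orthonormal_sequence (fun j => v j.+1),
      forall j, (1 <= j)%N -> T (v j) = lam j *: v j &
      forall x, (forall j, (1 <= j)%N -> ip (v j) x = 0) -> T x = 0].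

(* Eigenvalues are listed with multiplicity, so this says that the eigenvalues
   are pairwise different and simple. *)
Definition distinct_eigenvalues (T : H -> H) : Prop :=
  exists lam v, eigen_system T lam v /\
    forall i j, (1 <= i)%N -> (1 <= j)%N -> i <> j -> lam i <> lam j.

End hilbert.

Definition separable (T : topologicalType) : Prop :=
  exists2 D : set T, countable D & dense D.

Definition infinite_dimensional (R : realType) (V : lmodType R) : Prop :=
  forall (n : nat) (s : 'I_n -> V),
    exists x, forall c : 'I_n -> R, x <> \sum_(i < n) c i *: s i.

Section random_elements.
Context {R : realType} {H : completeNormedModType R}.
Context {d : measure_display} {Omega : measurableType d}.
Variable P : probability Omega R.

Definition random_element (Z : Omega -> H) : Prop :=
  measurable_fun [set: Omega] (Z : Omega -> g_sigma_algebraType (@open H)).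

Definition nu (p : R) (Z : Omega -> H) : \bar R :=
  Lnorm P p%:E (fun w => (`|Z w|)%:E).

Definition in_LpH (p : R) (Z : Omega -> H) : Prop :=
  random_element Z /\ (nu p Z < +oo)%E.

Variable ip : {dot H for idfun}.

(* mu = E[Z], the expectation of an integrable H-valued random element: the
   unique mu with E<v, Z> = <v, mu> for all v. *)
Definition is_mean (Z : Omega -> H) (mu : H) : Prop :=
  [/\ random_element Z, ('E_P[fun w => (`|Z w|)%R] < +oo)%E &
      forall v, ('E_P[fun w => ip v (Z w)] = (ip v mu)%:E)%E].

(* T = E[Z (x) W], that is, T v = E[<Z, v> W] for all v. *)
Definition is_cross_cov (Z W : Omega -> H) (T : H -> H) : Prop :=
  forall v, is_mean (fun w => tensor ip (Z w) (W w) v) (T v).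

Definition orthogonal_elements (Z W : Omega -> H) : Prop :=
  is_cross_cov Z W (fun=> 0).

Definition white_noise (I : Type) (D : set I) (Z : I -> Omega -> H) : Prop :=
  [/\ forall i, D i -> in_LpH 2 (Z i),
      forall i j, D i -> D j -> i <> j -> orthogonal_elements (Z i) (Z j) &
      exists (mu : H) (V : H -> H), forall i, D i ->
        is_mean (Z i) mu /\
        is_cross_cov (fun w => Z i w - mu) (fun w => Z i w - mu) V].

(* The series converges in L^2_H. *)
Definition ARH1 (Psi : H -> H) (X : nat -> Omega -> H)
    (eps : int -> Omega -> H) : Prop :=
  forall n, (1 <= n)%N ->
    [/\ random_element (X n),
        nu 2 (fun w => X n w -
          \sum_(0 <= j < N) iter j Psi (eps (n%:Z - j%:Z) w))
            @[N --> \oo] --> 0%E &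
        {ae P, forall w, X n.+1 w = Psi (X n w) + eps n.+1%:Z w}].

End random_elements.

Section innovations.
Context {d' : measure_display} {S : measurableType d'}.

(* Generators of the product sigma-algebra on S^I. *)
Definition cylinders (I : Type) : set (set (I -> S)) :=
  [set A | exists (i : I) (B : set S), measurable B /\ A = [set s | B (s i)]].

Context {R : realType} {H : completeNormedModType R}.
Context {d : measure_display} {Omega : measurableType d}.
Variable P : probability Omega R.
Implicit Types delta : int -> Omega -> S.

Definition iid delta : Prop :=
  [/\ forall i, measurable_fun [set: Omega] (delta i),
      forall i (A : set S), measurable A ->
        P (delta i @^-1` A) = P (delta 0 @^-1` A) &
      forall (J : seq int) (A : int -> set S), uniq J ->
        (forall i, measurable (A i)) ->
        P [set w | forall i, i \in J -> A i (delta i w)] =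
        (\prod_(i <- J) P (delta i @^-1` A i))%E].

Definition path_of delta (w : Omega) : int -> S := fun i => delta i w.

(* delta' has the same law as delta, as a random element of S^Z, and is
   independent of it. *)
Definition independent_copy delta delta' : Prop :=
  [/\ forall i, measurable_fun [set: Omega] (delta' i),
      forall A, <<s @cylinders int >> A ->
        P (path_of delta' @^-1` A) = P (path_of delta @^-1` A) &
      forall A B, <<s @cylinders int >> A -> <<s @cylinders int >> B ->
        P (path_of delta @^-1` A `&` path_of delta' @^-1` B) =
        (P (path_of delta @^-1` A) * P (path_of delta' @^-1` B))%E].

(* (delta_n, delta_(n-1), ...) *)
Definition past delta (n : nat) (w : Omega) : nat -> S :=
  fun i => delta (n%:Z - i%:Z) w.

(* (delta_n, ..., delta_(n-m+1), delta'_(n-m), delta'_(n-m-1), ...) *)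
Definition coupled_past delta delta' (n m : nat) (w : Omega) : nat -> S :=
  fun i => if (i < m)%N then delta (n%:Z - i%:Z) w else delta' (n%:Z - i%:Z) w.

(* L^p-m-approximability of (Z_n)_(n >= 1), represented through f and the
   innovations delta, with independent copy delta'. *)
Definition Lp_m_approximable (p : R) (Z : nat -> Omega -> H)
    (f : (nat -> S) -> H) delta delta' : Prop :=
  [/\ measurable_fun setT
        (f : g_sigma_algebraType (@cylinders nat) ->
             g_sigma_algebraType (@open H)),
      forall n, (1 <= n)%N -> in_LpH P p (Z n),
      forall n, (1 <= n)%N -> {ae P, forall w, Z n w = f (past delta n w)} &
      (\sum_(1 <= m <oo)
         nu P p (fun w => (Z m w - f (coupled_past delta delta' m m w))%R)
       < +oo)%E].

End innovations.

Section linear_model.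
Context {R : realType} {H : completeNormedModType R}.
Context {d : measure_display} {Omega : measurableType d}.
Variables (P : probability Omega R) (ip : {dot H for idfun}).

Definition assumption_A (Psi : H -> H) (X Y e : nat -> Omega -> H) : Prop :=
  [/\ continuous Psi,
      forall k, (1 <= k)%N -> {ae P, forall w, Y k w = Psi (X k w) + e k w},
      forall k, (1 <= k)%N -> is_mean P ip (X k) 0 /\ is_mean P ip (e k) 0,
      exists (d' : measure_display) (S : measurableType d')
             (delta delta' : int -> Omega -> S) (f g : (nat -> S) -> H),
        [/\ iid P delta, independent_copy P delta delta',
            Lp_m_approximable P 4 X f delta delta' &
            Lp_m_approximable P 4 e g delta delta'] &
      white_noise P ip [set k | (1 <= k)%N] e /\
      forall k, (1 <= k)%N -> orthogonal_elements P ip (X k) (e k)].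

(* Chat = sample_cross_cov X X, Deltahat = sample_cross_cov X Y. *)
Definition sample_cross_cov (X Y : nat -> Omega -> H) (n : nat) (w : Omega) :
    H -> H :=
  fun v => n%:R^-1 *: \sum_(1 <= k < n.+1) tensor ip (X k w) (Y k w) v.

End linear_model.

Section estimator.
Context {R : realType} {H : completeNormedModType R}.
Variable ip : {dot H for idfun}.
Implicit Types (lam : nat -> R) (m : R).

Definition eigengap lam (j : nat) : R :=
  if (j == 1)%N then lam 1%N - lam 2%N
  else Num.min (lam j.-1 - lam j) (lam j - lam j.+1).

(* Extended-real inversion satisfies 0^-1 = +oo; supremum 0 A is the maximum of
   A when A is nonempty and bounded, and 0 when A is empty. *)
Definition B_cut lam m : nat :=
  supremum 0%N [set j : nat | (1 <= j)%N /\ ((lam j)%:E^-1 <= m%:E)%E].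

Definition E_cut lam m : nat :=
  supremum 0%N [set k : nat | (1 <= k)%N /\
    (\big[maxe/-oo]_(1 <= j < k.+1) (eigengap lam j)%:E^-1 <= m%:E)%E].

Definition K_cut lam m : nat :=
  Num.truncn (Num.min (Num.min (B_cut lam m)%:R (E_cut lam m)%:R) m).

Definition Psi_hat (lam : nat -> R) (v : nat -> H) (Deltahat : H -> H)
    (K : nat) : H -> H :=
  fun x => \sum_(1 <= j < K.+1) ((lam j)^-1 * ip (v j) x) *: Deltahat (v j).

End estimator.

Definition cvg0_in_probability {R : realType} {d : measure_display}
    {Omega : measurableType d} (P : probability Omega R)
    (Z : nat -> Omega -> \bar R) : Prop :=
  forall e : R, 0 < e -> P [set w | (e%:E < Z n w)%E] @[n --> \oo] --> 0%E.

(* Main.v *)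
(** A least-squares identity removes all eigenvector perturbation theory:
  since Y_k = Psi (X_k) + e_k, one has Deltahat = Psi o Chat + R_n with R_n the
  empirical cross covariance of (X_k) and (e_k). Writing Pi_K for the projection
  onto the span of vhat_1, ..., vhat_K, the estimation error is therefore
  Psi (Pi_K - I) + R_n o (sum_(j <= K) lamhat_j^-1 vhat_j (x) vhat_j),
  and its second term is at most m_n |R_n|.  For the first term, Psi is compact
  and C has dense range, so it suffices that (I - Pi_K) C y is small, and this
  is at most (|Chat - C| + lamhat_(K+1)) |y|.  Since lamhat_j^-1 <= m_n is implied by
  the condition on the gaps, Weyl's inequality gives K_n -> oo in probability,
  hence lamhat_(K+1) -> 0.

  It remains to bound Chat - C and R_n in Hilbert-Schmidt norm: both have second
  moment O(1/n).  For k < l the cross term E<Z_k, Z_l> of the centered tensors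
  vanishes when Z_l is replaced by its coupled version with lag l - k, which is
  independent of the past up to time k; the replacement error is summable by
  L^4-m-approximability. *)

Require Import Defs.
From HB Require Import structures.
From mathcomp Require Import all_boot all_order all_algebra sesquilinear.
From mathcomp Require Import all_classical all_reals all_analysis.
From mathcomp Require Import measurable_realfun zify ring lra.

Set Implicit Arguments.
Unset Strict Implicit.
Unset Printing Implicit Defensive.

Import Order.TTheory GRing.Theory Num.Theory.
Import numFieldNormedType.Exports.

Local Open Scope classical_set_scope.
Local Open Scope ring_scope.

(** * Orthonormal sequences in a Hilbert space *)

(** Tensors are handled through their coordinates [ip (b i) x * ip (b j) y], which are real
    functions of the innovations. A scalar variance bound applies to each pair (i, j), and Parseval
    adds these bounds up to a Hilbert-Schmidt norm. For the total to stay finite, the AM-GM weight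
    attached to lag m must be the same for all coordinates: a weight [r m] dominating the L^4
    coupling errors at lag m turns a squared error of order [r m ^+ 2] into [r m], which is
    summable.

    Coupling becomes a matter of index maps. Pasts, coupled pasts and their translates are injective
    reindexings of one i.i.d. family over [int * bool], so equality of laws comes from injectivity
    and independence from disjoint images.

    Perturbation and probability are kept apart. Two thresholds d and m0, depending only on [Psi], C
    and the tolerance, make the error small as soon as |Chat - C| <= d, m_n |R_n| <= d and m0 <=
    m_n. The two bad events then have probability O(1/n) and O(m_n^2/n). *)

Section inner_product.
Context {R : realType} {H : completeNormedModType R} (ip : {dot H for idfun}).

Lemma ipC x y : ip x y = ip y x.
Proof. by rewrite hermC /= expr0 mul1r. Qed.

Lemma ipDl x y z : ip (x + y) z = ip x z + ip y z.
Proof. exact: linearDl. Qed.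

Lemma ipDr x y z : ip x (y + z) = ip x y + ip x z.
Proof. exact: linearDr. Qed.

Lemma ipBl x y z : ip (x - y) z = ip x z - ip y z.
Proof. exact: linearBl. Qed.

Lemma ipBr x y z : ip x (y - z) = ip x y - ip x z.
Proof. exact: linearBr. Qed.

Lemma ipZl a x y : ip (a *: x) y = a * ip x y.
Proof. exact: linearZl_LR. Qed.

Lemma ipZr a x y : ip x (a *: y) = a * ip x y.
Proof. exact: linearZr_LR. Qed.

Lemma ip0r x : ip x 0 = 0.
Proof. exact: linear0r. Qed.

Lemma ip_suml (I : Type) (s : seq I) (p : pred I) (F : I -> H) x :
  ip (\sum_(i <- s | p i) F i) x = \sum_(i <- s | p i) ip (F i) x.
Proof. exact: linear_sumlz. Qed.

Lemma ip_sumr (I : Type) (s : seq I) (p : pred I) (F : I -> H) x :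
  ip x (\sum_(i <- s | p i) F i) = \sum_(i <- s | p i) ip x (F i).
Proof. exact: linear_sumr. Qed.

Hypothesis H_inner : norm_from_inner ip.

Lemma ip_ge0 x : 0 <= ip x x.
Proof. by rewrite -H_inner sqr_ge0. Qed.

Lemma cauchy_schwarz_sqr x y : ip x y ^+ 2 <= ip x x * ip y y.
Proof.
have [->|y0] := eqVneq y 0; first by rewrite !ip0r expr0n mulr0.
have yy : 0 < ip y y.
  by rewrite -H_inner exprn_gt0 // normr_gt0.
(* The squared norm of this vector is [ip y y] times the defect in the inequality, so no quotient
   appears. *)
have := ip_ge0 (ip y y *: x - ip x y *: y).
rewrite !(ipBl, ipBr, ipZl, ipZr) (ipC y x) => h.
have : 0 <= ip y y * (ip x x * ip y y - ip x y ^+ 2).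
  by apply: le_trans h _; rewrite le_eqVlt; apply/orP; left; apply/eqP; ring.
by rewrite pmulr_rge0 // subr_ge0.
Qed.

Lemma cauchy_schwarz x y : `|ip x y| <= `|x| * `|y|.
Proof.
rewrite -ler_sqr ?nnegrE ?mulr_ge0 // real_normK ?num_real // exprMn !H_inner.
exact: cauchy_schwarz_sqr.
Qed.

Lemma ip_continuous x : continuous (ip x).
Proof.
move=> y; apply/cvgrPdist_le => e e0.
have x1 : 0 < `|x| + 1 by rewrite ltr_wpDl.
near=> z.
rewrite -ipBr (le_trans (cauchy_schwarz _ _))//.
have : `|y - z| <= e / (`|x| + 1).
  by near: z; apply: cvgr_dist_le => //; rewrite divr_gt0.
rewrite ler_pdivlMr// => h.
by apply: le_trans h; rewrite mulrC ler_wpM2l// lerDl.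
Unshelve. all: by end_near. Qed.

Lemma norm_le_ip x M : 0 <= M -> ip x x <= M ^+ 2 -> `|x| <= M.
Proof. by move=> M0; rewrite -H_inner ler_sqr ?nnegrE. Qed.

Section orthonormal.
Variables (v : nat -> H).
Hypothesis von : orthonormal_sequence ip v.

Definition proj_seq (N : nat) (x : H) : H := \sum_(i < N) ip (v i) x *: v i.

Lemma ip_proj_seq N x i :
  ip (v i) (proj_seq N x) = if (i < N)%N then ip (v i) x else 0.
Proof.
rewrite ip_sumr.
under eq_bigr do rewrite ipZr von.
case: ltnP => iN.
  rewrite (bigD1 (Ordinal iN))//= eqxx mulr1 big1 ?addr0// => j ji.
  by rewrite (_ : i == j = false) ?mulr0//; apply: contraNF ji => /eqP ij; apply/eqP/val_inj.
rewrite big1// => j _; rewrite (_ : i == j = false) ?mulr0//.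
by apply/negP => /eqP ij; move: (ltn_ord j); rewrite -ij ltnNge iN.
Qed.

Lemma ip_lincomb N (c : nat -> R) x :
  ip (\sum_(i < N) c i *: v i) x = \sum_(i < N) c i * ip (v i) x.
Proof. by rewrite ip_suml; under eq_bigr do rewrite ipZl. Qed.

Lemma lincomb_sqr N (c : nat -> R) :
  ip (\sum_(i < N) c i *: v i) (\sum_(i < N) c i *: v i) = \sum_(i < N) c i ^+ 2.
Proof.
rewrite ip_lincomb; apply: eq_bigr => i _.
rewrite ip_sumr (bigD1 i)//= ipZr von eqxx mulr1 big1 ?addr0 ?expr2// => j ji.
by rewrite ipZr von eq_sym (_ : val j == val i = false) ?mulr0//; exact: negbTE.
Qed.

Lemma proj_seq_sqr N x : ip (proj_seq N x) (proj_seq N x) = \sum_(i < N) ip (v i) x ^+ 2.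
Proof. exact: (lincomb_sqr N (fun i => ip (v i) x)). Qed.

Lemma ip_proj_seq_r N x : ip (proj_seq N x) x = \sum_(i < N) ip (v i) x ^+ 2.
Proof.
by rewrite (ip_lincomb N (fun i => ip (v i) x)); apply: eq_bigr => i _; rewrite expr2.
Qed.

Lemma pythagoras N x :
  ip x x = \sum_(i < N) ip (v i) x ^+ 2 + ip (x - proj_seq N x) (x - proj_seq N x).
Proof.
rewrite !(ipBl, ipBr) (ipC x (proj_seq N x)) proj_seq_sqr ip_proj_seq_r; ring.
Qed.

Lemma bessel N x : \sum_(i < N) ip (v i) x ^+ 2 <= `|x| ^+ 2.
Proof. by rewrite H_inner (pythagoras N x) lerDl ip_ge0. Qed.

Lemma sub_proj_seq_le N x : `|x - proj_seq N x| <= `|x|.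
Proof.
apply: norm_le_ip => //; rewrite H_inner [leRHS](pythagoras N x) lerDr.
by apply: sumr_ge0 => i _; exact: sqr_ge0.
Qed.

(** The two squared distances differ by the sum of the squares of [c i - ip (v i) x]. This turns
    density of a span into convergence of the projections. *)
Lemma proj_seq_best N (c : nat -> R) x :
  `|x - proj_seq N x| <= `|x - \sum_(i < N) c i *: v i|.
Proof.
apply: norm_le_ip => //; rewrite H_inner.
set y := \sum_(i < N) _.
have -> : ip (x - proj_seq N x) (x - proj_seq N x) = ip x x - \sum_(i < N) ip (v i) x ^+ 2.
  by rewrite [in RHS](pythagoras N x); ring.
have -> : ip (x - y) (x - y) = ip x x - ip y x - ip y x + ip y y.
  by rewrite ipBl !ipBr (ipC x y); ring.
rewrite /y lincomb_sqr ip_lincomb.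
rewrite -subr_ge0 (_ : _ - _ = \sum_(i < N) (c i - ip (v i) x) ^+ 2).
  by apply: sumr_ge0 => i _; exact: sqr_ge0.
set s := \sum_(i < N) _ * _.
rewrite [RHS](_ : _ = \sum_(i < N) c i ^+ 2 - s - s + \sum_(i < N) ip (v i) x ^+ 2).
  by ring.
rewrite /s -!sumrB -big_split/=; apply: eq_bigr => i _; ring.
Qed.

Lemma ip_sub_proj_seq N x i : (i < N)%N -> ip (v i) (x - proj_seq N x) = 0.
Proof. by move=> iN; rewrite ipBr ip_proj_seq iN subrr. Qed.

(** The partial Bessel sums [u] increase and are bounded, and by Pythagoras the squared distance
    between two projections is a difference of values of [u]. The sequence [v] need not be complete,
    so the limit may differ from [x]. *)
Lemma proj_seq_cauchy x : cvg (proj_seq ^~ x @ \oo).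
Proof.
apply: cauchy_cvg; apply: cauchy_exP => e e0.
pose u N := \sum_(i < N) ip (v i) x ^+ 2.
have und : nondecreasing_seq u.
  apply/nondecreasing_seqP => N; rewrite /u big_ord_recr/= lerDl; exact: sqr_ge0.
have ucv : cvgn u.
  apply: nondecreasing_is_cvgn => //; exists (`|x| ^+ 2) => _ [N _ <-].
  exact: bessel.
have e2 : 0 < e ^+ 2 by rewrite exprn_gt0.
have /cvgrPdist_lt /(_ _ e2) [N _ hN] := ucv.
exists (proj_seq N x); exists N => //= M NM.
rewrite -ball_normE/=.
rewrite -ltr_sqr ?nnegrE ?(ltW e0)// H_inner.
have -> : ip (proj_seq N x - proj_seq M x) (proj_seq N x - proj_seq M x) = u M - u N.
  have -> : proj_seq N x = proj_seq N (proj_seq M x).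
    by apply: eq_bigr => i _; rewrite ip_proj_seq (leq_trans (ltn_ord i) NM).
  have h := pythagoras N (proj_seq M x).
  rewrite proj_seq_sqr in h; rewrite -opprB (linearNl ip) (linearNr ip) opprK.
  rewrite /u h.
  have -> : \sum_(i < N) ip (v i) (proj_seq M x) ^+ 2 = \sum_(i < N) ip (v i) x ^+ 2.
    by apply: eq_bigr => i _; rewrite ip_proj_seq (leq_trans (ltn_ord i) NM).
  ring.
apply: (@le_lt_trans _ _ (limn u - u N)).
  by rewrite lerB// nondecreasing_cvgn_le.
by apply: le_lt_trans (hN _ (leqnn N)); rewrite ler_norm.
Qed.

End orthonormal.

Lemma basis_proj_seq_cvg (b : nat -> H) x : orthonormal_basis ip b ->
  proj_seq b N x @[N --> \oo] --> x.
Proof.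
move=> [bon bd]; apply/cvgrPdist_lt => e e0.
have : closure [set x | exists (n : nat) (c : nat -> R), x = \sum_(i < n) c i *: b i] x.
  by rewrite bd.
move=> /(_ (ball x e)); case; first exact: nbhsx_ballx.
move=> y [[n [c yE]]]; rewrite -ball_normE/= => xy.
exists n => //= N nN.
apply: le_lt_trans xy.
(* Padding with zero coefficients makes [y] a competitor for the best approximation at every
   [N >= n]. *)
have -> : y = \sum_(i < N) (if (i < n)%N then c i else 0) *: b i.
  rewrite yE -(big_mkord xpredT (fun i => c i *: b i)).
  rewrite -(big_mkord xpredT (fun i => (if (i < n)%N then c i else 0) *: b i)).
  rewrite [RHS](@big_cat_nat _ _ _ n)//=.
  under [X in _ = _ + X]eq_big_nat => i /andP[ni _] do
    rewrite ltnNge ni/= scale0r.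
  rewrite big1_eq addr0; apply: eq_big_nat => i /andP[_ h]; by rewrite h.
have := proj_seq_best bon N (fun i => if (i < n)%N then c i else 0) x; exact. 
Qed.

Lemma parseval (b : nat -> H) x : orthonormal_basis ip b ->
  \sum_(i < N) ip (b i) x ^+ 2 @[N --> \oo] --> `|x| ^+ 2.
Proof.
move=> bb; have [bon _] := bb.
have h := @basis_proj_seq_cvg b x bb.
have h2 : `|proj_seq b N x| ^+ 2 @[N --> \oo] --> `|x| ^+ 2.
  by under eq_fun do rewrite expr2; rewrite expr2; apply: cvgM; apply: cvg_norm.
rewrite (_ : (fun N => \sum_(i < N) _) = (fun N => `|proj_seq b N x| ^+ 2))//.
by apply/funext => N; rewrite H_inner proj_seq_sqr.
Qed.

End inner_product.

(** * Eigenvalues of symmetric operators and Weyl's inequality *)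

Section spectral.
Context {R : realType} {H : completeNormedModType R} (ip : {dot H for idfun}).
Hypothesis H_inner : norm_from_inner ip.

Section eigen_system_theory.
Variables (T : {linear H -> H}) (lam : nat -> R) (v : nat -> H).
Hypotheses (Tc : continuous T) (Tsym : forall x y, ip x (T y) = ip (T x) y).
Hypothesis Teig : eigen_system ip T lam v.

Let u j := v j.+1.

Lemma eigen_ge0 j : (1 <= j)%N -> 0 <= lam j.
Proof. by case: Teig => h _ _ _ /h[]. Qed.

Lemma eigen_nincr i j : (1 <= i <= j)%N -> lam j <= lam i.
Proof.
case: Teig => h _ _ _ /andP[i1]; elim: j => [|j IH]; first by rewrite leqn0 => /eqP ->.
rewrite leq_eqVlt => /predU1P[->//|]; rewrite ltnS => ij.
by apply: le_trans (IH ij); case: (h j (leq_trans i1 ij)).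
Qed.

Lemma eigen_on : orthonormal_sequence ip u.
Proof. by case: Teig. Qed.

Lemma eigenE j : T (u j) = lam j.+1 *: u j.
Proof. by case: Teig => _ _ h _; rewrite /u h. Qed.

Lemma eigen_lincomb N (c : nat -> R) :
  T (\sum_(i < N) c i *: u i) = \sum_(i < N) (c i * lam i.+1) *: u i.
Proof.
by rewrite linear_sum; apply: eq_bigr => i _; rewrite linearZ/= eigenE scalerA.
Qed.

(** [x] may be replaced by the limit [y] of its projections: [x - y] is orthogonal to all
    eigenvectors, hence killed by [T] by the last clause of [eigen_system]. On the projections [T]
    is diagonal, and only eigenvalues from [lam K.+1] on meet a nonzero coordinate. *)
Lemma eigen_norm_le K x : (forall j, (j < K)%N -> ip (u j) x = 0) ->
  `|T x| <= lam K.+1 * `|x|.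
Proof.
move=> xK.
have uon := eigen_on.
have /cvg_ex[y sy] := @proj_seq_cauchy _ _ ip H_inner u uon x.
have -> : T x = T y.
  case: Teig => _ _ _ T0; apply/eqP; rewrite -subr_eq0 -linearB; apply/eqP.
  apply: T0 => -[//|j] _; rewrite -/(u j).
  have h : ip (u j) (x - proj_seq ip u N x) @[N --> \oo] --> ip (u j) (x - y).
    apply: (@cvg_comp _ _ _ (fun N => x - proj_seq ip u N x) (ip (u j)) _ (nbhs (x - y))).
      by apply: cvgB => //; exact: cvg_cst.
    exact: (ip_continuous H_inner).
  have h0 : ip (u j) (x - proj_seq ip u N x) @[N --> \oo] --> (0 : R).
    apply: cvg_near_cst; exists j.+1 => //= N jN.
    exact: ip_sub_proj_seq.
  exact: (cvg_unique _ h h0).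
have h1 : `|T (proj_seq ip u N x)| @[N --> \oo] --> `|T y|.
  apply: cvg_norm.
  by apply: (@cvg_comp _ _ _ (fun N => proj_seq ip u N x) T _ (nbhs y)) => //; exact: Tc.
have h2 : (fun=> lam K.+1 * `|x|) @ \oo --> lam K.+1 * `|x| by exact: cvg_cst.
apply: (ler_cvg_to h1 h2); near=> N.
have l0 : 0 <= lam K.+1 by exact: eigen_ge0.
apply: (norm_le_ip H_inner); first by rewrite mulr_ge0.
have -> := eigen_lincomb N (fun i => ip (u i) x).
have -> := lincomb_sqr uon N (fun i => ip (u i) x * lam i.+1).
rewrite exprMn.
apply: (@le_trans _ _ (lam K.+1 ^+ 2 * \sum_(i < N) ip (u i) x ^+ 2)); last first.
  by rewrite ler_wpM2l ?sqr_ge0// bessel.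
rewrite mulr_sumr; apply: ler_sum => i _.
rewrite exprMn mulrC.
case: (ltnP i K) => iK; first by rewrite xK// expr0n/= !mulr0.
rewrite ler_wpM2r ?sqr_ge0// ler_sqr ?nnegrE ?eigen_ge0//.
exact: eigen_nincr.
Unshelve. all: by end_near. Qed.

Lemma eigen_proj_comm K x : proj_seq ip u K (T x) = T (proj_seq ip u K x).
Proof.
rewrite (eigen_lincomb K (fun i => ip (u i) x)); apply: eq_bigr => i _.
by rewrite Tsym eigenE ipZl mulrC.
Qed.

Lemma eigen_residual K x : `|T (x - proj_seq ip u K x)| <= lam K.+1 * `|x|.
Proof.
have uon := eigen_on.
have h j : (j < K)%N -> ip (u j) (x - proj_seq ip u K x) = 0.
  exact: ip_sub_proj_seq.
apply: le_trans (eigen_norm_le h) _.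
by rewrite ler_wpM2l ?eigen_ge0 ?sub_proj_seq_le.
Qed.

(** The partial trace over the first j eigenvectors is at least [j * lam j] by monotonicity. This
    explicit decay does the work of compactness. *)
Lemma eigen_trace M : (forall J, \sum_(i < J) ip (u i) (T (u i)) <= M) ->
  forall j, (1 <= j)%N -> lam j <= M / j%:R.
Proof.
move=> h j j1; rewrite ler_pdivlMr ?ltr0n//; apply: le_trans (h j).
rewrite mulr_natr -[X in _ *+ X]card_ord -sumr_const; apply: ler_sum => i _.
rewrite eigenE ipZr eigen_on eqxx mulr1; apply: eigen_nincr; exact: ltn_ord.
Qed.

End eigen_system_theory.

Lemma row_kernel_exists (F : fieldType) (j k : nat) (A : 'M[F]_(j, k)) : (k < j)%N ->
  exists2 c : 'rV_j, c != 0 & c *m A = 0.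
Proof.
move=> kj; have : kermx A != 0.
  rewrite -mxrank_eq0 mxrank_ker subn_eq0 -ltnNge.
  by apply: leq_ltn_trans kj; exact: rank_leq_col.
move=> /rowV0Pn[c cA c0]; exists c => //; exact/sub_kermxP.
Qed.

(* Courant--Fischer: the span of the first j eigenvectors of T contains a
   nonzero vector orthogonal to the first j - 1 eigenvectors of T'. *)
Lemma weyl (T T' : {linear H -> H}) lam lam' v v' (d : R) :
  continuous T' -> eigen_system ip T lam v -> eigen_system ip T' lam' v' ->
  (forall x, `|T x - T' x| <= d * `|x|) ->
  forall j, (1 <= j)%N -> lam j <= lam' j + d.
Proof.
move=> T'c eT eT' TT' [//|j] _.
pose A := \matrix_(i < j.+1, k < j) ip (v i.+1) (v' k.+1).
have [c c0 cA] := row_kernel_exists A (ltnSn j).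
pose cc (i : nat) : R := c 0 (inord i).
have ccE (i : 'I_j.+1) : cc i = c 0 i by rewrite /cc inord_val.
pose x := \sum_(i < j.+1) cc i *: v i.+1.
have uon := eigen_on eT.
have xx : ip x x = \sum_(i < j.+1) cc i ^+ 2 by exact: (lincomb_sqr uon).
have x0 : 0 < ip x x.
  rewrite xx lt0r; apply/andP; split; last by apply: sumr_ge0 => i _; exact: sqr_ge0.
  rewrite psumr_eq0; last by move=> i _; exact: sqr_ge0.
  apply: contraNN c0 => /allP h; apply/eqP/rowP => i; rewrite mxE -ccE.
  by have := h i (mem_index_enum _); rewrite /= sqrf_eq0 => /eqP.
have xv' k : (k < j)%N -> ip (v' k.+1) x = 0.
  move=> kj; have := congr1 (fun B : 'rV_j => B 0 (Ordinal kj)) cA.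
  rewrite !mxE => <-; rewrite ipC (ip_lincomb ip (fun i => v i.+1)).
  by apply: eq_bigr => i _; rewrite ccE mxE.
have h1 := eigen_norm_le T'c eT' xv'.
have h2 : lam j.+1 * ip x x <= ip x (T x).
  rewrite (_ : T x = \sum_(i < j.+1) (cc i * lam i.+1) *: v i.+1); last first.
    exact: (eigen_lincomb eT).
  rewrite ipC (ip_lincomb ip (fun i => v i.+1) _ (fun i => cc i * lam i.+1)).
  rewrite xx mulr_sumr; apply: ler_sum => i _.
  have -> : ip (v i.+1) x = cc i.
    rewrite ip_sumr (bigD1 i)//= ipZr (uon i i) eqxx mulr1 big1 ?addr0// => k ki.
    by rewrite ipZr (uon i k) eq_sym (_ : val k == val i = false) ?mulr0//; exact: negbTE.
  rewrite mulrAC -expr2 mulrC ler_wpM2l ?sqr_ge0//.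
  by apply: (eigen_nincr eT); exact: ltn_ord.
have h3 : ip x (T' x) <= lam' j.+1 * ip x x.
  apply: le_trans (ler_norm _) _; apply: le_trans (cauchy_schwarz H_inner _ _) _.
  by rewrite -H_inner expr2 mulrCA ler_wpM2l.
have h4 : ip x (T x) - ip x (T' x) <= d * ip x x.
  rewrite -ipBr.
  apply: le_trans (ler_norm _) _; apply: le_trans (cauchy_schwarz H_inner _ _) _.
  by rewrite -H_inner expr2 mulrCA ler_wpM2l.
rewrite -(ler_pM2r x0) mulrDl; lra.
Qed.

End spectral.

(** * The truncation level *)

(** The condition [0 < k] excludes the empty set, whose supremum is the default 0. A bounded
    nonempty set of naturals attains its supremum, and downward closure does the rest. The cut-offs
    are thereby described by membership alone. *)
Lemma leq_supremum_nat (A : set nat) (M k : nat) : ubound A M ->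
  (forall i j, (0 < i <= j)%N -> A j -> A i) -> (0 < k)%N ->
  (k <= supremum 0%N A)%N <-> A k.
Proof.
move=> AM Adown k0.
have [A0|/set0P An0] := eqVneq A set0.
  by rewrite A0 supremum0 leqn0 (gtn_eqF k0).
have bP : exists i, `[< A i >] by case: An0 => i Ai; exists i; apply/asboolP.
have bM i : `[< A i >] -> (i <= M)%N by move=> /asboolP /AM.
have [s As smax] : exists2 s, A s & forall i, A i -> (i <= s)%N.
  case: (ex_maxnP bP bM) => s /asboolP As smax; exists s => // i Ai.
  by apply: smax; apply/asboolP.
have supP : supremums A s by split => [i /smax|i /(_ _ As)].
have -> : supremum 0%N A = s.
  rewrite /supremum; case: ifPn => [/eqP A0|_]; first by case: An0; rewrite A0.
  case: xgetP => [t _ tP|/(_ _ supP)//].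
  exact: is_subset1_supremums tP supP.
by split=> [ks|/smax//]; apply: Adown As; rewrite k0.
Qed.

Section cut_offs.
Context {R : realType}.
Implicit Types (lam : nat -> R) (m : R).

(** At [r = 0] the extended inverse is [+oo] and both sides are false; elsewhere inversion reverses
    the order. *)
Lemma inve_le_fin (r m : R) : 0 <= r -> 0 < m ->
  (r%:E^-1 <= m%:E)%E = (m^-1 <= r).
Proof.
move=> r0 m0; rewrite inver; case: eqP => [->|/eqP rn0].
  by rewrite leye_eq/=; apply/esym/negbTE; rewrite -ltNge invr_gt0.
have rp : 0 < r by rewrite lt0r rn0.
rewrite lee_fin; apply/idP/idP => h.
  by rewrite -(invrK r) lef_pV2 ?posrE// invr_gt0.
by rewrite -(invrK m) lef_pV2 ?posrE// invr_gt0.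
Qed.

Lemma bigmaxe_leP (F : nat -> \bar R) m (k : nat) :
  (\big[maxe/-oo]_(1 <= j < k.+1) F j <= m%:E)%E <->
  forall j, (0 < j <= k)%N -> (F j <= m%:E)%E.
Proof.
elim: k => [|k IH].
  rewrite big_nil; split=> [_ j|_]; last exact: leNye.
  by case: j.
rewrite big_nat_recr//= ge_max; split.
  move=> /andP[/IH h1 h2] j /andP[j0]; rewrite leq_eqVlt => /predU1P[->//|].
  by rewrite ltnS => jk; apply: h1; rewrite j0.
move=> h; apply/andP; split; last by apply: h; rewrite ltnS leqnn.
by apply/IH => j /andP[j0 jk]; apply: h; rewrite j0/= (leq_trans jk).
Qed.

Section decreasing.
Variable lam : nat -> R.
Hypothesis lam_decr : forall j, (1 <= j)%N -> lam j.+1 <= lam j /\ 0 <= lam j.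

Lemma decr_le i j : (0 < i <= j)%N -> lam j <= lam i.
Proof.
move=> /andP[i1]; elim: j => [|j IH]; first by rewrite leqn0 => /eqP ->.
rewrite leq_eqVlt => /predU1P[->//|]; rewrite ltnS => ij.
by apply: le_trans (IH ij); case: (lam_decr (leq_trans i1 ij)).
Qed.

Lemma eigengap_le j : (0 < j)%N -> eigengap lam j <= lam j.
Proof.
move=> j0; have h : lam j - lam j.+1 <= lam j.
  by rewrite gerBl; case: (@lam_decr j.+1).
by rewrite /eigengap; case: eqP => [j1|_]; [rewrite j1 in h *|rewrite ge_min h orbT].
Qed.

Lemma eigengap_ge0 j : (0 < j)%N -> 0 <= eigengap lam j.
Proof.
rewrite /eigengap; case: j => [//|[|j]] _.
  by rewrite eqxx subr_ge0; case: (@lam_decr 1%N).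
by rewrite /= le_min !subr_ge0; case: (@lam_decr j.+1) => // ->; case: (@lam_decr j.+2) => // ->.
Qed.

(** The condition behind [B_cut] follows from the gap condition at [k], since a gap never exceeds
    its eigenvalue. An eigenvalue below [m^-1] bounds both index sets, so that the suprema are
    maxima, and rounding down is harmless when comparing with a positive integer. *)
Lemma K_cutP m k : 0 < m -> (forall e, 0 < e -> exists2 j, (0 < j)%N & lam j < e) ->
  (0 < k)%N ->
  (k <= K_cut lam m)%N <->
  k%:R <= m /\ forall j, (0 < j <= k)%N -> m^-1 <= eigengap lam j.
Proof.
move=> m0 lam0 k0; have im0 : 0 < m^-1 by rewrite invr_gt0.
have [N N0 hN] := lam0 _ im0.
have lamN j : (0 < j)%N -> m^-1 <= lam j -> (j <= N)%N.
  move=> j0 h; rewrite leqNgt; apply/negP => Nj.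
  have lN : lam j <= lam N by apply: decr_le; rewrite N0 ltnW.
  by have := le_lt_trans (le_trans h lN) hN; rewrite ltxx.
have BE : (k <= B_cut lam m)%N <-> m^-1 <= lam k.
  rewrite /B_cut (@leq_supremum_nat _ N)//=.
  - by split=> [[_]|]; rewrite inve_le_fin//; case: (@lam_decr k).
  - by move=> i /= [i0]; rewrite inve_le_fin//; [exact: lamN|case: (@lam_decr i)].
  - move=> i j /andP[i0 ij] [j0]; rewrite !inve_le_fin//; last 2 first.
      by case: (@lam_decr i).
      by case: (@lam_decr j).
    by move=> /le_trans h; split => //; apply: h; apply: decr_le; rewrite i0.
have gapE k' : (0 < k')%N ->
    (\big[maxe/-oo]_(1 <= j < k'.+1) (eigengap lam j)%:E^-1 <= m%:E)%E <->
    forall j, (0 < j <= k')%N -> m^-1 <= eigengap lam j.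
  move=> _; rewrite bigmaxe_leP; split => h j jk; have := h j jk;
    by rewrite inve_le_fin// eigengap_ge0//; case/andP: jk.
have EE : (k <= E_cut lam m)%N <-> forall j, (0 < j <= k)%N -> m^-1 <= eigengap lam j.
  rewrite /E_cut (@leq_supremum_nat _ N)//=.
  - by rewrite gapE//; split=> [[]|].
  - move=> i /= [i0]; rewrite gapE// => /(_ i); rewrite i0 leqnn => /(_ isT) h.
    by apply: lamN => //; apply: le_trans h (eigengap_le _).
  - move=> i j /andP[i0 ij] [j0]; rewrite !gapE// => h; split => // l /andP[l0 li].
    by apply: h; rewrite l0 (leq_trans li).
have -> : (k <= K_cut lam m)%N = (k%:R <= Num.min (Num.min (B_cut lam m)%:R (E_cut lam m)%:R) m).
  by rewrite /K_cut; case: k k0 {BE EE} => // k _; rewrite truncn_gt_nat.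
rewrite !le_min !ler_nat; split.
  by move=> /andP[/andP[_ /EE h] ->].
move=> [-> h]; rewrite andbT; apply/andP; split; last exact/EE.
by apply/BE; apply: le_trans (eigengap_le k0); apply: h; rewrite k0 leqnn.
Qed.

End decreasing.
End cut_offs.

(** * Hilbert-Schmidt operators *)

Section hilbert_schmidt.
Context {R : realType} {H : completeNormedModType R} (ip : {dot H for idfun}).
Hypothesis H_inner : norm_from_inner ip.
Variable b : nat -> H.
Hypothesis bb : orthonormal_basis ip b.

(** This is Cauchy-Schwarz in R^M, read off from the one in [H] by placing the coefficients along
    the orthonormal vectors [b i]. *)
Lemma sum_cauchy_schwarz (M : nat) (a c : nat -> R) :
  (\sum_(i < M) a i * c i) ^+ 2 <= (\sum_(i < M) a i ^+ 2) * (\sum_(i < M) c i ^+ 2).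
Proof.
have bon := proj1 bb.
have := cauchy_schwarz_sqr H_inner (\sum_(i < M) a i *: b i) (\sum_(i < M) c i *: b i).
rewrite !(lincomb_sqr bon) (_ : ip _ _ = \sum_(i < M) a i * c i)//.
rewrite ip_lincomb; apply: eq_bigr => i _; congr (_ * _).
rewrite ip_sumr (bigD1 i)//= ipZr (bon i i) eqxx mulr1 big1 ?addr0// => j ji.
by rewrite ipZr (bon i j) eq_sym (_ : val j == val i = false) ?mulr0//; exact: negbTE.
Qed.

Lemma norm_lincomb_le (M : nat) (a : nat -> R) (z : nat -> H) :
  `|\sum_(i < M) a i *: z i| ^+ 2 <=
  (\sum_(i < M) a i ^+ 2) * (\sum_(i < M) `|z i| ^+ 2).
Proof.
have := sum_cauchy_schwarz M (fun i => `|a i|) (fun i => `|z i|).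
under [X in _ <= X * _]eq_bigr do rewrite real_normK ?num_real//.
have s0 : 0 <= \sum_(i < M) `|a i| * `|z i| by apply: sumr_ge0 => i _; exact: mulr_ge0.
apply: le_trans; rewrite ler_sqr ?nnegrE//.
by apply: le_trans (ler_norm_sum _ _ _) _; under eq_bigr do rewrite normrZ.
Qed.

Lemma continuous_proj_cvg (T : {linear H -> H}) y : continuous T ->
  \sum_(i < N) ip (b i) y *: T (b i) @[N --> \oo] --> T y.
Proof.
move=> Tc.
rewrite (_ : (fun N => _) = T \o (proj_seq ip b ^~ y)); last first.
  apply/funext => N; rewrite /= linear_sum; apply: eq_bigr => i _.
  by rewrite linearZ.
apply: (@cvg_comp _ _ _ (proj_seq ip b ^~ y) T _ (nbhs y)); last exact: Tc.
exact: (basis_proj_seq_cvg H_inner bb).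
Qed.

(** The Hilbert-Schmidt norm dominates the operator norm: expand [y] in the basis, apply
    Cauchy-Schwarz and Bessel to the partial sums, and pass to the limit. *)
Lemma hs_bound (T : {linear H -> H}) h y : continuous T -> 0 <= h ->
  (forall N, \sum_(i < N) `|T (b i)| ^+ 2 <= h ^+ 2) -> `|T y| <= h * `|y|.
Proof.
move=> Tc h0 hT.
have h1 : `|\sum_(i < N) ip (b i) y *: T (b i)| @[N --> \oo] --> `|T y|.
  exact: cvg_norm (@continuous_proj_cvg T y Tc).
have h2 : (fun=> h * `|y|) @ \oo --> h * `|y| by exact: cvg_cst.
apply: (ler_cvg_to h1 h2); near=> N.
rewrite -ler_sqr ?nnegrE ?mulr_ge0// exprMn [leRHS]mulrC.
apply: le_trans (norm_lincomb_le N (fun i => ip (b i) y) (fun i => T (b i))) _.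
apply: ler_pM => //; try by apply: sumr_ge0 => i _; exact: sqr_ge0.
exact: (bessel H_inner (proj1 bb)).
Unshelve. all: by end_near. Qed.

(** The tail is written with zeros in the first [N] places, the shape to which [norm_lincomb_le]
    applies. *)
Lemma hs_tail (T : {linear H -> H}) B e : 0 < e ->
  (forall N, \sum_(i < N) `|T (b i)| ^+ 2 <= B) ->
  exists N, forall M, (N <= M)%N ->
    \sum_(i < M) `|if (i < N)%N then 0 else T (b i)| ^+ 2 <= e.
Proof.
move=> e0 hT; pose u N := \sum_(i < N) `|T (b i)| ^+ 2.
have und : nondecreasing_seq u.
  apply/nondecreasing_seqP => N; rewrite /u big_ord_recr/= lerDl; exact: sqr_ge0.
have ucv : cvgn u.
  apply: nondecreasing_is_cvgn => //; exists B => _ [N _ <-]; exact: hT.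
have /cvgrPdist_le /(_ _ e0) [N _ hN] := ucv.
exists N => M NM.
have -> : \sum_(i < M) `|if (i < N)%N then 0 else T (b i)| ^+ 2 = u M - u N.
  rewrite /u -!(big_mkord xpredT (fun i => `|T (b i)| ^+ 2)).
  rewrite -(big_mkord xpredT (fun i => `|if (i < N)%N then 0 else T (b i)| ^+ 2)).
  rewrite (@big_cat_nat _ _ _ N 0 M)//= [in RHS](@big_cat_nat _ _ _ N 0 M)//= addrAC subrr add0r.
  under eq_big_nat => i /andP[_ iN] do rewrite iN normr0 expr0n/=.
  rewrite big1_eq add0r; apply: eq_big_nat => i /andP[Ni _].
  by rewrite ltnNge Ni.
apply: (@le_trans _ _ (limn u - u N)).
  by rewrite lerB// nondecreasing_cvgn_le.
by apply: le_trans (hN _ (leqnn N)); rewrite ler_norm.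
Qed.

Lemma HS_norm_bound (T : H -> H) : (HS_norm b T < +oo)%E ->
  exists B, forall N, \sum_(i < N) `|T (b i)| ^+ 2 <= B.
Proof.
move=> /lty_poweRy h.
have {h} : (\sum_(0 <= j <oo) (`|T (b j)| ^+ 2)%:E < +oo)%E by apply: h; rewrite invr_eq0.
set s := (X in (X < _)%E) => sy.
have s0 : (0 <= s)%E by apply: nneseries_ge0 => i _ _; rewrite lee_fin sqr_ge0.
exists (fine s) => N.
rewrite -lee_fin fineK ?ge0_fin_numE// -sumEFin -(big_mkord xpredT (fun i => (`|T (b i)| ^+ 2)%:E)).
by apply: nneseries_lim_ge => i _ _; rewrite lee_fin sqr_ge0.
Qed.

(* A Hilbert--Schmidt operator kills I - Pi_K asymptotically, as soon as Pi_K
   projects on the leading eigenvectors of an operator Chat close to C and C has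
   dense range: (I - Pi_K) C y = (I - Pi_K) (C - Chat) y + Chat (I - Pi_K) y. *)
Lemma projection_residual (Psi C : {linear H -> H}) B e : continuous Psi ->
  (forall N, \sum_(i < N) `|Psi (b i)| ^+ 2 <= B) ->
  closure (range C) = [set: H] -> 0 < e ->
  exists2 d, 0 < d & forall (Chat : {linear H -> H}) lam v K,
    continuous Chat -> (forall x y, ip x (Chat y) = ip (Chat x) y) ->
    eigen_system ip Chat lam v ->
    (forall x, `|C x - Chat x| <= d * `|x|) -> lam K.+1 <= d ->
    forall x, `|x| <= 1 -> `|Psi (x - proj_seq ip (fun j => v j.+1) K x)| <= e.
Proof.
move=> Psic PsiB Cd e0.
have e2 : 0 < e / 2 by rewrite divr_gt0.
have e22 : 0 < (e / 2) ^+ 2 by rewrite exprn_gt0.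
(* The basis vectors beyond [N] contribute at most [e / 2] on the unit ball. The other half is left
   for the finitely many [b i] with [i < N]. *)
have [N hN] := hs_tail e22 PsiB.
pose S := \sum_(i < N) `|Psi (b i)|.
have S0 : 0 <= S by apply: sumr_ge0.
have S1 : 0 < 1 + S by rewrite ltr_pwDl.
(* Each [Q (b i)] below has norm at most [2 * t], so the first [N] terms add up to at most
   [2 * t * S <= e / 2]. Here and in [1 + Y] the summand 1 keeps the denominator positive. *)
pose t := e / (4 * (1 + S)).
have t0 : 0 < t by rewrite divr_gt0// mulr_gt0.
have /choice[y hy] : forall i, exists y, `|b i - C y| <= t.
  move=> i.
  have : closure (range C) (b i) by rewrite Cd.
  move=> /(_ _ (nbhsx_ballx (b i) t t0)) [_ [[z _ <-]]].
  by rewrite -ball_normE/= => /ltW h; exists z.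
pose Y := \sum_(i < N) `|y i|.
have Y0 : 0 <= Y by apply: sumr_ge0.
have Y1 : 0 < 1 + Y by rewrite ltr_pwDl.
(* With this radius [d * (1 + Y) = t / 2], and the two errors at [y i], from [C - Chat] and from the
   residual of [Chat], share [t]. *)
exists (t / (2 * (1 + Y))); first by rewrite divr_gt0// mulr_gt0.
set d := t / _ => Chat lam v K Chatc Chats eig CC lamd x x1.
have d0 : 0 < d by rewrite divr_gt0// mulr_gt0.
set u := fun j => v j.+1.
have uon : orthonormal_sequence ip u by exact: eigen_on eig.
pose Q z := z - proj_seq ip u K z.
have QB z w : Q (z - w) = Q z - Q w.
  rewrite /Q [proj_seq ip u K (z - w)](_ : _ = proj_seq ip u K z - proj_seq ip u K w).
    by rewrite !opprB [LHS]addrACA [RHS]addrACA [- w + _]addrC.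
  by rewrite /proj_seq -sumrB; apply: eq_bigr => i _; rewrite ipBr scalerBl.
have Qle z : `|Q z| <= `|z| by exact: sub_proj_seq_le.
(* Symmetry moves the projection from [x] to the basis vectors: only finitely many [Q (b i)] have to
   be small, and the estimate is uniform over the unit ball. *)
have Qsym z w : ip z (Q w) = ip (Q z) w.
  rewrite /Q ipBr ipBl; congr (_ - _); rewrite ip_sumr ip_suml.
  by apply: eq_bigr => i _; rewrite ipZr ipZl (ipC ip z) mulrC.
have QC z : `|Q (Chat z)| <= d * `|z|.
  rewrite /Q (eigen_proj_comm Chats eig) -linearB.
  by apply: le_trans (eigen_residual H_inner Chatc eig K z) _; rewrite ler_wpM2r.
have Qb i : (i < N)%N -> `|Q (b i)| <= 2 * t.
  move=> iN.
  have -> : Q (b i) = Q (b i - C (y i)) + (Q (C (y i) - Chat (y i)) + Q (Chat (y i))).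
    by rewrite !QB subrK subrK.
  have yi : `|y i| <= Y.
    by rewrite /Y (bigD1 (Ordinal iN))//= lerDl sumr_ge0.
  apply: le_trans (ler_normD _ _) _.
  have -> : 2 * t = t + t by ring.
  apply: lerD; first exact: le_trans (Qle _) (hy i).
  apply: le_trans (ler_normD _ _) _.
  have -> : t = d * (1 + Y) + d * (1 + Y).
    by rewrite /d; field; rewrite gt_eqF.
  have dy : d * `|y i| <= d * (1 + Y).
    by rewrite ler_pM2l// (le_trans yi)// lerDr.
  apply: lerD; last exact: le_trans (QC _) dy.
  by apply: le_trans (Qle _) _; apply: le_trans (CC _) dy.
rewrite -/u -/(Q x); set z := Q x.
have z1 : `|z| <= 1 by exact: le_trans (Qle _) x1.
have h1 : `|\sum_(i < N) ip (b i) z *: Psi (b i)| @[N --> \oo] --> `|Psi z|.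
  exact: cvg_norm (@continuous_proj_cvg Psi z Psic).
have h2 : (fun=> e) @ \oo --> e by exact: cvg_cst.
apply: (ler_cvg_to h1 h2); near=> M.
have NM : (N <= M)%N by near: M; exists N.
have -> : \sum_(i < M) ip (b i) z *: Psi (b i) =
    \sum_(i < N) ip (b i) z *: Psi (b i) +
    \sum_(i < M) ip (b i) z *: (if (i < N)%N then 0 else Psi (b i)).
  rewrite -!(big_mkord xpredT (fun i => ip (b i) z *: Psi (b i))).
  rewrite -(big_mkord xpredT (fun i => ip (b i) z *: (if (i < N)%N then 0 else Psi (b i)))).
  rewrite (@big_cat_nat _ _ _ N 0 M)//=; congr (_ + _).
  rewrite [RHS](@big_cat_nat _ _ _ N 0 M)//=.
  under [X in _ = X + _]eq_big_nat => i /andP[_ iN] do rewrite iN scaler0.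
  rewrite big1_eq add0r; apply: eq_big_nat => i /andP[Ni _].
  by rewrite ltnNge Ni.
apply: le_trans (ler_normD _ _) _.
have -> : e = e / 2 + e / 2 by field.
apply: lerD.
  apply: le_trans (ler_norm_sum _ _ _) _.
  apply: (@le_trans _ _ (2 * t * S)).
    rewrite /S mulr_sumr; apply: ler_sum => i _; rewrite normrZ ler_wpM2r//.
    rewrite Qsym; apply: le_trans (cauchy_schwarz H_inner _ _) _.
    by rewrite -[leRHS]mulr1; apply: ler_pM => //; exact: Qb.
  apply: (@le_trans _ _ (2 * t * (1 + S))).
    by apply: ler_wpM2l; [exact: mulr_ge0 (ltW t0)|rewrite lerDr].
  by rewrite /t le_eqVlt; apply/orP; left; apply/eqP; field; rewrite gt_eqF.
rewrite -ler_sqr ?nnegrE ?(ltW e2)//.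
apply: le_trans (norm_lincomb_le M (fun i => ip (b i) z) (fun i => if (i < N)%N then 0 else Psi (b i))) _.
rewrite -[leRHS]mul1r; apply: ler_pM; try by apply: sumr_ge0 => i _; exact: sqr_ge0.
  apply: le_trans (bessel H_inner (proj1 bb) M z) _.
  by rewrite expr_le1.
exact: hN.
Unshelve. all: by end_near. Qed.

End hilbert_schmidt.

(** * Deterministic bound on the estimation error *)

Section perturbation.
Context {R : realType} {H : completeNormedModType R} (ip : {dot H for idfun}).
Hypothesis H_inner : norm_from_inner ip.

Lemma eigengap_gt0 (T : H -> H) lam v : eigen_system ip T lam v ->
  (forall i j, (1 <= i)%N -> (1 <= j)%N -> i <> j -> lam i <> lam j) ->
  forall j, (0 < j)%N -> 0 < eigengap lam j.
Proof.
move=> [lamd _ _ _] lamn.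
have lt i : (0 < i)%N -> lam i.+1 < lam i.
  move=> i0; case: (lamd i i0) => h _; rewrite lt_neqAle h andbT; apply/eqP.
  by apply: lamn => //; apply/eqP; rewrite gtn_eqF.
rewrite /eigengap => -[//|[|j]] _; first by rewrite eqxx subr_gt0 lt.
by rewrite /= lt_min !subr_gt0 !lt.
Qed.

Lemma uniform_eigengap (T : H -> H) lam v k : eigen_system ip T lam v ->
  (forall i j, (1 <= i)%N -> (1 <= j)%N -> i <> j -> lam i <> lam j) ->
  exists2 g, 0 < g & forall j, (0 < j <= k)%N -> g <= eigengap lam j.
Proof.
move=> eT lamn; elim: k => [|k [g g0 hg]]; first by exists 1 => // -[].
exists (Num.min g (eigengap lam k.+1)).
  by rewrite lt_min g0/= (eigengap_gt0 eT lamn).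
move=> j /andP[j0]; rewrite leq_eqVlt => /predU1P[->|]; first by rewrite ge_min lexx orbT.
by rewrite ltnS => jk; rewrite ge_min hg// j0.
Qed.

Lemma eigengap_perturb (lam lam' : nat -> R) d j : (0 < j)%N ->
  (forall i, (0 < i)%N -> `|lam i - lam' i| <= d) ->
  eigengap lam j <= eigengap lam' j + d + d.
Proof.
move=> j0 h; have h' i : (0 < i)%N -> - d <= lam i - lam' i <= d.
  by move=> i0; rewrite -ler_norml h.
rewrite /eigengap; case: eqP => [j1|/eqP jn1].
  by have := h' 1%N isT; have := h' 2%N isT; move=> /andP[? ?] /andP[? ?]; lra.
rewrite -addrA -lerBlDr.
have j1 : (0 < j.-1)%N by case: j j0 jn1 => [//|[|]].
have := h' _ j1; have := h' _ j0; have := h' j.+1 isT.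
move=> /andP[? ?] /andP[? ?] /andP[? ?].
rewrite le_min !lerBlDr; apply/andP; split; rewrite ge_min; apply/orP; [left|right]; lra.
Qed.

Lemma weyl_abs (T T' : {linear H -> H}) lam lam' v v' (d : R) :
  continuous T -> continuous T' ->
  eigen_system ip T lam v -> eigen_system ip T' lam' v' ->
  (forall x, `|T x - T' x| <= d * `|x|) ->
  forall j, (0 < j)%N -> `|lam j - lam' j| <= d.
Proof.
move=> Tc T'c eT eT' TT' j j0.
have h1 := weyl H_inner T'c eT eT' TT' j0.
have T'T x : `|T' x - T x| <= d * `|x| by rewrite distrC.
have h2 := weyl H_inner Tc eT' eT T'T j0.
by rewrite ler_norml; apply/andP; split; lra.
Qed.

Lemma Psi_hat_decomposition (Psi Chat : {linear H -> H}) (Rn Delta : {linear H -> H})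
    lam v K x :
  eigen_system ip Chat lam v -> (forall y, Delta y = Psi (Chat y) + Rn y) ->
  (forall j, (0 < j <= K)%N -> lam j != 0) ->
  Psi_hat ip lam v Delta K x =
  Psi (proj_seq ip (fun j => v j.+1) K x) +
  Rn (\sum_(i < K) ((lam i.+1)^-1 * ip (v i.+1) x) *: v i.+1).
Proof.
move=> eig DE lam0; rewrite /Psi_hat big_add1/= big_mkord !linear_sum -big_split/=.
apply: eq_bigr => i _.
have li : lam i.+1 != 0 by apply: lam0; rewrite /= ltn_ord.
rewrite DE scalerDr !linearZ/= (eigenE eig i) linearZ/= scalerA; congr (_ *: _ + _).
by rewrite mulrAC mulVf// mul1r.
Qed.

(** No probability is involved: [d] and [m0] are fixed before the sample operators, so in the end it
    suffices that the hypotheses on [Chat] and [Rn] hold outside an event of small probability. *)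
Lemma estimator_error_bound (b : nat -> H) (Psi C : {linear H -> H}) B M e :
  orthonormal_basis ip b -> continuous Psi -> continuous C ->
  (forall N, \sum_(i < N) `|Psi (b i)| ^+ 2 <= B) ->
  closure (range C) = [set: H] -> distinct_eigenvalues ip C ->
  (forall u, orthonormal_sequence ip u ->
     forall J, \sum_(i < J) ip (u i) (C (u i)) <= M) ->
  0 < e ->
  exists d m0, [/\ 0 < d, 0 < m0 &
    forall (Chat Rn Delta : {linear H -> H}) lam v m r,
    continuous Chat -> (forall x y, ip x (Chat y) = ip (Chat x) y) ->
    eigen_system ip Chat lam v ->
    (forall t, 0 < t -> exists2 j, (0 < j)%N & lam j < t) ->
    (forall x, `|C x - Chat x| <= d * `|x|) ->
    (forall x, `|Rn x| <= r * `|x|) -> 0 <= r -> r * m <= d ->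
    (forall y, Delta y = Psi (Chat y) + Rn y) ->
    m0 <= m ->
    forall x, `|x| <= 1 ->
      `|Psi_hat ip lam v Delta (K_cut lam m) x - Psi x| <= e].
Proof.
move=> bb Psic Cc PsiB Cd [lamC [vC [eC lamCn]]] CM e0.
have e2 : 0 < e / 2 by rewrite divr_gt0.
have [d1 d10 hd1] := projection_residual H_inner bb Psic PsiB Cd e2.
have uCon := eigen_on eC.
have lamCM := eigen_trace eC (CM _ uCon).
have M0 : 0 <= M by apply: le_trans (CM _ uCon 0%N); rewrite big_ord0.
(* From index [k0] on, the eigenvalues of [C] are at most [d1 / 2]. Once the cut-off reaches [k0],
   Weyl's inequality makes the next eigenvalue of [Chat] at most [d1]. *)
have [k0 k00 k0M] : exists2 k0, (0 < k0)%N & M / k0%:R <= d1 / 2.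
  exists (Num.truncn (M / (d1 / 2))).+1 => //.
  rewrite ler_pdivrMr// mulrC -ler_pdivrMr ?divr_gt0//.
  exact/ltW/truncnS_gt.
have [g g0 hg] := uniform_eigengap k0 eC lamCn.
(* The three bounds serve different ends. [d1 / 2] completes the eigenvalue bound [d1]; [g / 4]
   leaves the first [k0] gaps of [Chat] at least [g - 2 * d >= g / 2], which exceeds [m^-1] for
   [m >= m0], so that the cut-off reaches [k0]; [e / 2] absorbs the term with [Rn]. *)
pose d := Num.min (Num.min (d1 / 2) (g / 4)) (e / 2).
have d0 : 0 < d by rewrite !lt_min !divr_gt0.
have dd1 : d <= d1 / 2 by rewrite !ge_min lexx.
have dg : d <= g / 4 by rewrite !ge_min lexx orbT.
have de : d <= e / 2 by rewrite ge_min lexx orbT.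
exists d, (Num.max k0%:R (g / 2)^-1); split=> //.
  by rewrite lt_max ltr0n k00.
move=> Chat Rn Delta lam v m r Chatc Chats eig lamto0 CC Rnr r0 rm DE m0m x x1.
have m0 : 0 < m.
  by apply: lt_le_trans m0m; rewrite lt_max ltr0n k00.
have mk : k0%:R <= m by apply: le_trans m0m; rewrite le_max lexx.
have mg : m^-1 <= g / 2.
  rewrite -[leRHS]invrK lef_pV2 ?posrE ?invr_gt0 ?divr_gt0//.
  by apply: le_trans m0m; rewrite le_max lexx orbT.
set K := K_cut lam m.
have lamd : forall j, (1 <= j)%N -> lam j.+1 <= lam j /\ 0 <= lam j by case: eig.
have wl := weyl_abs Cc Chatc eC eig CC.
have k0K : (k0 <= K)%N.
  apply/(K_cutP lamd m0 lamto0 k00); split=> // j jk.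
  have /andP[j0 _] := jk.
  have := eigengap_perturb j0 wl; have := hg j jk; lra.
have lamK j : (0 < j <= K)%N -> m^-1 <= lam j.
  move=> /andP[j0 jK]; have K0 : (0 < K)%N by exact: leq_trans j0 jK.
  have [_ h] := proj1 (K_cutP lamd m0 lamto0 K0) (leqnn K).
  by apply: le_trans (eigengap_le lamd j0); apply: h; rewrite j0.
have lamK0 j : (0 < j <= K)%N -> 0 < lam j.
  by move=> /lamK; apply: lt_le_trans; rewrite invr_gt0.
rewrite (Psi_hat_decomposition x eig DE); last by move=> j /lamK0; rewrite lt0r => /andP[].
set Pix := proj_seq ip _ K x; set w := \sum_(i < K) _.
have -> : Psi Pix + Rn w - Psi x = Rn w - Psi (x - Pix).
  by rewrite linearB opprB [RHS]addrCA addrA.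
apply: le_trans (ler_normB _ _) _.
have -> : e = e / 2 + e / 2 by field.
apply: lerD.
  (* The inverses [(lam i.+1)^-1] up to the cut-off are at most [m], so Bessel gives [|w| <= m] and
     the term is at most [r * m <= d]. *)
  apply: le_trans (Rnr _) _; apply: le_trans de; apply: le_trans rm.
  apply: ler_wpM2l => //; apply: (norm_le_ip H_inner); first exact: ltW.
  rewrite (lincomb_sqr (eigen_on eig) _ (fun i => (lam i.+1)^-1 * ip (v i.+1) x)).
  apply: (@le_trans _ _ (m ^+ 2 * \sum_(i < K) ip (v i.+1) x ^+ 2)).
    rewrite mulr_sumr; apply: ler_sum => i _; rewrite exprMn ler_wpM2r ?sqr_ge0//.
    have iK : (0 < i.+1 <= K)%N by rewrite /= ltn_ord.
    rewrite ler_sqr ?nnegrE ?invr_ge0 ?(ltW m0) ?(ltW (lamK0 _ iK))//.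
    by rewrite -[leRHS]invrK lef_pV2 ?posrE ?invr_gt0 ?lamK0 ?lamK.
  rewrite -[leRHS]mulr1 ler_wpM2l ?sqr_ge0//.
  apply: le_trans (bessel H_inner (eigen_on eig) K x) _.
  by rewrite expr_le1.
apply: (hd1 Chat lam v K) => //.
  move=> y; apply: le_trans (CC y) _; rewrite ler_wpM2r//; lra.
apply: (@le_trans _ _ (lam k0)).
  by apply: (eigen_nincr eig); rewrite k00 (leq_trans k0K).
have := wl _ k00; have := lamCM _ k00.
rewrite ler_norml => h /andP[h1 h2]; lra.
Qed.

End perturbation.

(** * Laws and independence of subfamilies of an i.i.d. family *)

Section rectangles.
Context {d' : measure_display} {S : measurableType d'} (K : choiceType).

(** Unlike the cylinders over one coordinate, these are closed under intersection, as the uniqueness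
    theorem for measures requires. *)
Definition rectangles : set (set (K -> S)) :=
  [set A | exists (J : seq K) (B : K -> set S), (forall k, measurable (B k)) /\
     A = [set s | forall k, k \in J -> B k (s k)]].

Lemma rectanglesT : rectangles setT.
Proof.
by exists [::], (fun=> setT); split=> //; apply/seteqP; split.
Qed.

Lemma rectanglesI : setI_closed rectangles.
Proof.
move=> _ _ [J [B [mB ->]]] [J' [B' [mB' ->]]].
exists (J ++ J'), (fun k => (if k \in J then B k else setT) `&` (if k \in J' then B' k else setT)).
split=> [k|]; first by apply: measurableI; case: ifP.
apply/seteqP; split=> s /=.
  move=> [h h'] k kJ; split; case: ifPn => // kJ'; [exact: h|exact: h'].
move=> h; split=> k kJ; have := h k; rewrite mem_cat kJ ?orbT => /(_ isT) [].
  by [].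
by [].
Qed.

Lemma sigma_rectangles : <<s rectangles>> = <<s @cylinders _ S K>>.
Proof.
apply/seteqP; split.
  apply: smallest_sub; first exact: smallest_sigma_algebra.
  move=> _ [J [B [mB ->]]].
  have -> : [set s : K -> S | forall k, k \in J -> B k (s k)] =
            \big[setI/setT]_(k <- J) [set s | B k (s k)].
    apply/seteqP; split=> s /=; rewrite -bigcap_seq /=.
      by move=> h k /= kJ; exact: h.
    by move=> h k kJ; exact: h.
  apply: (@big_ind _ (<<s @cylinders _ S K>>)).
  - exact: (@measurableT _ (g_sigma_algebraType (@cylinders _ S K))).
  - move=> A A' mA mA'; exact: (@measurableI _ (g_sigma_algebraType (@cylinders _ S K))).
  - by move=> k _; apply: sub_sigma_algebra; exists k, (B k).
apply: smallest_sub; first exact: smallest_sigma_algebra.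
move=> A [k [B [mB ->]]]; apply: sub_sigma_algebra.
exists [:: k], (fun=> B); split=> //; apply/seteqP; split=> s /=.
  by move=> h j; rewrite inE => /eqP ->.
by apply; rewrite inE.
Qed.

End rectangles.

Section independence.
Context {R : realType} {d : measure_display} {Omega : measurableType d}.
Variable P : probability Omega R.

(** As functions of [A], both sides are finite measures agreeing on a pi-system that contains the
    whole space. One factor is a fixed event [E], so two applications, one for each factor, pass
    from generators to sigma-algebras. *)
Lemma independent_generator d1 (T1 : measurableType d1) (G : set (set T1))
    (f : Omega -> T1) (E : set Omega) :
  @measurable _ T1 = <<s G>> -> setI_closed G -> G setT ->
  measurable_fun setT f -> measurable E ->
  (forall A, G A -> P (f @^-1` A `&` E) = (P (f @^-1` A) * P E)%E) ->
  forall A, measurable A -> P (f @^-1` A `&` E) = (P (f @^-1` A) * P E)%E.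
Proof.
move=> mG GI GT mf mE h A mA.
have PE0 : 0 <= fine (P E) by exact: fine_ge0.
pose m1 : {measure set T1 -> \bar R} :=
  pushforward (mrestr P mE) f.
pose m2 : {measure set T1 -> \bar R} :=
  mscale (NngNum PE0) (pushforward P f).
have PEE : ((fine (P E))%:E = P E)%E by rewrite fineK ?fin_num_measure.
have m2E B : m2 mf B = (P (f @^-1` B) * P E)%E by rewrite /m2 /= /mscale /= PEE muleC.
rewrite -m2E.
apply: (@measure_unique _ _ _ G (fun=> setT) mG GI _ _ (m1 mf) (m2 mf) _ _ A mA) => //.
- by apply/seteqP; split=> // x _; exists 0%N.
- by move=> B GB; rewrite [RHS]m2E -h.
- move=> _; rewrite /m1 /=/pushforward /mrestr preimage_setT setTI.
  by apply: le_lt_trans (probability_le1 P mE) _; rewrite ltry.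
Qed.

Lemma eq_law_generator d1 (T1 : measurableType d1) (G : set (set T1))
    (f g : Omega -> T1) :
  @measurable _ T1 = <<s G>> -> setI_closed G -> G setT ->
  measurable_fun setT f -> measurable_fun setT g ->
  (forall A, G A -> P (f @^-1` A) = P (g @^-1` A)) ->
  forall A, measurable A -> P (f @^-1` A) = P (g @^-1` A).
Proof.
move=> mG GI GT mf mg h A mA.
pose m1 : {measure set T1 -> \bar R} := pushforward P f.
pose m2 : {measure set T1 -> \bar R} := pushforward P g.
apply: (@measure_unique _ _ _ G (fun=> setT) mG GI _ _ (m1 mf) (m2 mg) _ _ A mA) => //.
- by apply/seteqP; split=> // x _; exists 0%N.
- move=> _; rewrite /m1 /=/pushforward preimage_setT.
  by apply: le_lt_trans (probability_le1 P measurableT) _; rewrite ltry.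
Qed.

End independence.

Section iid_family.
Context {R : realType} {d : measure_display} {Omega : measurableType d}.
Variable P : probability Omega R.
Context {d' : measure_display} {S : measurableType d'}.

(** The common law enters only through its values [q], and the index type is arbitrary, so that the
    innovations and their copy can form a single family. *)
Definition iid_family (I : choiceType) (q : set S -> \bar R) (theta : I -> Omega -> S) :=
  (forall i, measurable_fun setT (theta i)) /\
  forall (J : seq I) (A : I -> set S), uniq J -> (forall i, measurable (A i)) ->
    P [set w | forall i, i \in J -> A i (theta i w)] = (\prod_(i <- J) q (A i))%E.

Definition pathmap (I : Type) (theta : I -> Omega -> S) (w : Omega) :
  g_sigma_algebraType (@cylinders _ S I) := fun i => theta i w.

Lemma measurable_pathmap (I : Type) (theta : I -> Omega -> S) :
  (forall i, measurable_fun setT (theta i)) -> measurable_fun setT (pathmap theta).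
Proof.
move=> mth; apply: (@measurability _ _ Omega (g_sigma_algebraType (@cylinders _ S I)) setT
  (pathmap theta) (@cylinders _ S I)) => //.
by move=> _ [_ [i [B [mB ->]]] <-]; rewrite setTI -[X in measurable X]setTI; exact: mth.
Qed.

Variables (I : choiceType) (q : set S -> \bar R) (theta : I -> Omega -> S).
Hypothesis thiid : iid_family q theta.

Lemma iid_subfamily (K : choiceType) (s : K -> I) : injective s ->
  iid_family q (theta \o s).
Proof.
case: thiid => mth h sinj; split=> [k|J B uJ mB]; first exact: mth.
(* Intersecting over the fibre of [s] transports [B] to the index set [I]: by injectivity the result
   is [B k] at [s k], and everything off the image of [s]. *)
pose A i := [set x | forall k, s k = i -> B k x].
have AE k : A (s k) = B k.
  apply/seteqP; split=> x /=; first exact.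
  by move=> Bx j /sinj ->.
have mA i : measurable (A i).
  have [[k <-]|nk] := pselect (exists k, s k = i); first by rewrite AE.
  rewrite (_ : A i = setT)//; apply/seteqP; split=> // x _ k ski.
  by case: nk; exists k.
transitivity (P [set w | forall i, i \in map s J -> A i (theta i w)]).
  congr (P _); apply/seteqP; split=> w /=.
    by move=> hw _ /mapP[k kJ ->]; rewrite AE; exact: hw.
  by move=> hw k kJ; rewrite -AE; apply: hw; exact: map_f.
rewrite h ?map_inj_uniq// big_map.
by under eq_bigr do rewrite AE.
Qed.

Lemma measurable_subpath (K : Type) (s : K -> I) :
  measurable_fun setT (pathmap (theta \o s)).
Proof. by case: thiid => mth _; apply: measurable_pathmap => k; exact: mth. Qed.

Lemma rectangle_prob (K : choiceType) (s : K -> I) (J : seq K) (B : K -> set S) :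
  injective s -> (forall k, measurable (B k)) ->
  P (pathmap (theta \o s) @^-1` [set x | forall k, k \in J -> B k (x k)]) =
  (\prod_(k <- undup J) q (B k))%E.
Proof.
move=> sinj mB; have [_ h] := iid_subfamily sinj.
rewrite -(h _ _ (undup_uniq J) mB); congr (P _); apply/seteqP; split=> w /= hw k kJ.
  by apply: hw; rewrite -mem_undup.
by apply: hw; rewrite mem_undup.
Qed.

(** The probability of a rectangle depends on [q] alone. This one fact yields stationarity, equality
    in law of pasts and coupled pasts, and invariance under time shifts. *)
Lemma iid_subfamily_law (K : choiceType) (s t : K -> I) : injective s -> injective t ->
  forall A : set (g_sigma_algebraType (@cylinders _ S K)), measurable A ->
    P (pathmap (theta \o s) @^-1` A) = P (pathmap (theta \o t) @^-1` A).
Proof.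
move=> sinj tinj.
apply: (@eq_law_generator _ _ _ P _ (g_sigma_algebraType (@cylinders _ S K))
  (@rectangles _ S K) (pathmap (theta \o s)) (pathmap (theta \o t))).
- by rewrite sigma_rectangles.
- exact: rectanglesI.
- exact: rectanglesT.
- exact: measurable_subpath.
- exact: measurable_subpath.
- by move=> A [J [B [mB ->]]]; rewrite !rectangle_prob.
Qed.

(** After reduction to rectangles on both sides, the two subfamilies merge into one indexed by
    [K + L]. Disjointness of the images makes the merged index map injective, and the product over
    the merged list splits. *)
Lemma iid_subfamily_independent (K L : choiceType) (s : K -> I) (t : L -> I) :
  injective s -> injective t -> (forall k l, s k <> t l) ->
  forall (A : set (g_sigma_algebraType (@cylinders _ S K)))
         (B : set (g_sigma_algebraType (@cylinders _ S L))),
    measurable A -> measurable B ->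
    P (pathmap (theta \o s) @^-1` A `&` pathmap (theta \o t) @^-1` B) =
    (P (pathmap (theta \o s) @^-1` A) * P (pathmap (theta \o t) @^-1` B))%E.
Proof.
move=> sinj tinj st A B mA mB.
have ms := @measurable_subpath K s.
have mt := @measurable_subpath L t.
have msA : measurable (pathmap (theta \o s) @^-1` A).
  by rewrite -[X in measurable X]setTI; exact: ms.
rewrite setIC muleC; move: B mB.
apply: (@independent_generator _ _ _ P _ (g_sigma_algebraType (@cylinders _ S L))
  (@rectangles _ S L) (pathmap (theta \o t))) => //.
- by rewrite sigma_rectangles.
- exact: rectanglesI.
- exact: rectanglesT.
move=> _ [J' [B' [mB' ->]]].
have mB : measurable (pathmap (theta \o t) @^-1` [set x | forall l, l \in J' -> B' l (x l)]).
  rewrite -[X in measurable X]setTI; apply: mt => //=.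
  rewrite [X in X _](_ : _ = <<s @rectangles _ S L>>); last by rewrite sigma_rectangles.
  by apply: sub_sigma_algebra; exists J', B'.
rewrite setIC muleC; move: A mA {msA}.
apply: (@independent_generator _ _ _ P _ (g_sigma_algebraType (@cylinders _ S K))
  (@rectangles _ S K) (pathmap (theta \o s))) => //.
- by rewrite sigma_rectangles.
- exact: rectanglesI.
- exact: rectanglesT.
move=> _ [J [B [mB0 ->]]].
pose st' (x : K + L) := match x with inl k => s k | inr l => t l end.
have st'inj : injective st'.
  move=> [k|l] [k'|l'] //=; [by move=> /sinj ->|by move=> /st|by move=> /esym /st|by move=> /tinj ->].
pose C (x : K + L) := match x with inl k => B k | inr l => B' l end.
have mC x : measurable (C x) by case: x.
rewrite !rectangle_prob//.
have uJ : uniq (map inl (undup J) ++ map inr (undup J') : seq (K + L)).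
  rewrite cat_uniq !map_inj_uniq ?undup_uniq//=; try by move=> x y [].
  by rewrite andbT; apply/hasPn => _ /mapP[l _ ->]; apply/mapP => -[].
have := rectangle_prob (map inl (undup J) ++ map inr (undup J')) st'inj mC.
rewrite (undup_id uJ).
rewrite big_cat/= !big_map/= => <-.
congr (P _); apply/seteqP; split=> w /=.
  move=> [h1 h2] x; rewrite mem_cat => /orP[] /mapP[k + ->]/=; rewrite mem_undup => ?.
    exact: h1.
  exact: h2.
move=> h; split=> k kJ.
  by apply: (h (inl k)); rewrite mem_cat map_f ?mem_undup.
by apply: (h (inr k)); rewrite mem_cat orbC map_f ?mem_undup.
Qed.

End iid_family.

(** * Expectations under equal laws and of products of independent variables *)

Section law.
Context {R : realType} {d : measure_display} {Omega : measurableType d}.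
Variable P : probability Omega R.

Lemma ge0_eq_law_integral d1 (T1 : measurableType d1) (f g : Omega -> T1)
    (h : T1 -> \bar R) :
  measurable_fun setT f -> measurable_fun setT g -> measurable_fun setT h ->
  (forall x, (0 <= h x)%E) ->
  (forall A, measurable A -> P (f @^-1` A) = P (g @^-1` A)) ->
  (\int[P]_w h (f w) = \int[P]_w h (g w))%E.
Proof.
move=> mf mg mh h0 fg.
have <- := @ge0_integral_pushforward _ _ _ _ R f mf P setT h measurableT mh (fun y _ => h0 y).
have <- := @ge0_integral_pushforward _ _ _ _ R g mg P setT h measurableT mh (fun y _ => h0 y).
by apply: eq_measure_integral => A mA _; exact: fg.
Qed.

Lemma eq_law_integral d1 (T1 : measurableType d1) (f g : Omega -> T1)
    (h : T1 -> \bar R) :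
  measurable_fun setT f -> measurable_fun setT g -> measurable_fun setT h ->
  (forall A, measurable A -> P (f @^-1` A) = P (g @^-1` A)) ->
  (\int[P]_w h (f w) = \int[P]_w h (g w))%E.
Proof.
move=> mf mg mh fg; rewrite integralE [RHS]integralE.
rewrite -[fun w => h (f w)]/(h \o f) -[fun w => h (g w)]/(h \o g).
rewrite (funepos_comp h f) (funepos_comp h g) (funeneg_comp h f) (funeneg_comp h g); congr (_ - _)%E.
- exact: (ge0_eq_law_integral mf mg (measurable_funepos mh) (funepos_ge0 h) fg).
- exact: (ge0_eq_law_integral mf mg (measurable_funeneg mh) (funeneg_ge0 h) fg).
Qed.

(** Independence makes the law of the pair the product of the marginal laws. Fubini with [V]
    integrated first leaves an inner integral equal to a multiple of the mean of [V]. *)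
Lemma independent_integral_mul (U V : Omega -> R) :
  measurable_fun setT U -> measurable_fun setT V ->
  (forall A B, measurable A -> measurable B ->
    P (U @^-1` A `&` V @^-1` B) = (P (U @^-1` A) * P (V @^-1` B))%E) ->
  P.-integrable setT (EFin \o V) ->
  P.-integrable setT (fun w => (U w * V w)%:E) ->
  (\int[P]_w (V w)%:E = 0 -> \int[P]_w (U w * V w)%:E = 0)%E.
Proof.
move=> mU mV UV iV iUV V0.
pose U' : {RV P >-> R} := HB.pack U (isMeasurableFun.Build _ _ _ _ U mU).
pose V' : {RV P >-> R} := HB.pack V (isMeasurableFun.Build _ _ _ _ V mV).
have mUV : measurable_fun setT (fun w => (U w, V w)) by exact: measurable_fun_pair.
pose W : {RV P >-> (R * R)%type} := HB.pack (fun w => (U w, V w))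
  (isMeasurableFun.Build _ _ _ _ (fun w => (U w, V w)) mUV).
pose m1 := distribution P U'; pose m2 := distribution P V'.
have prodE X : measurable X -> (m1 \x m2)%E X = distribution P W X.
  apply: product_measure_unique => A B mA mB.
  by rewrite -UV.
pose g (z : R * R) := (z.1 * z.2)%:E : \bar R.
have mg : measurable_fun setT g.
  apply/measurable_EFinP; apply: measurable_funM.
    exact: measurable_fst.
  exact: measurable_snd.
have ig : (pushforward P W).-integrable setT g.
  exact: (@integrable_pushforward _ _ _ _ R W mUV P setT g mg).
have igx : (m1 \x m2)%E.-integrable setT g.
  apply/integrableP; split=> //; move/integrableP: ig => [_].
  by rewrite (@eq_measure_integral _ _ _ setT (distribution P W) (m1 \x m2)%E)// => A mA _; exact: prodE.
have := @integral_pushforward _ _ _ _ R W mUV P setT g mg iUV measurableT.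
rewrite preimage_setT => <-.
rewrite (_ : integral _ _ _ = \int[(m1 \x m2)%E]_z g z)%E; last first.
  by apply: eq_measure_integral => A mA _; apply/esym; exact: prodE.
rewrite -integral12_prod_meas1//=.
have iV2 : m2.-integrable setT (EFin : R -> \bar R).
  by apply: (@integrable_pushforward _ _ _ _ R V mV P setT (EFin : R -> \bar R)).
have E0 : (\int[m2]_y y%:E = 0)%E.
  rewrite -V0; have := @integral_pushforward _ _ _ _ R V mV P setT (EFin : R -> \bar R).
  by rewrite preimage_setT; apply.
rewrite /fubini_F; under eq_integral => x _.
  rewrite /g/=; under eq_integral do rewrite EFinM.
  rewrite integralZl// E0 mule0; over.
by rewrite integral0.
Qed.

End law.

(** * The innovations and their copy as one i.i.d. family *)

Section joint_family.
Context {R : realType} {d : measure_display} {Omega : measurableType d}.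
Variable P : probability Omega R.
Context {d' : measure_display} {S : measurableType d'}.
Variables (delta delta' : int -> Omega -> S).

(** The boolean [true] marks the copy. *)
Definition joint (i : int * bool) : Omega -> S :=
  if i.2 then delta' i.1 else delta i.1.

(** The index list splits by its boolean. Independence of the two paths factors the probability, and
    the factor of the copy is carried back to [delta] by equality of laws. *)
Lemma joint_iid : iid P delta -> independent_copy P delta delta' ->
  iid_family P (fun A => P (delta 0 @^-1` A)) joint.
Proof.
move=> [md sd id] [md' law ind]; split=> [[i [|]]|J A uJ mA]; [exact: md'|exact: md|].
pose J1 := [seq i.1 | i <- J & ~~ i.2]; pose J2 := [seq i.1 | i <- J & i.2].
have u1 : uniq J1.
  rewrite map_inj_in_uniq ?filter_uniq// => -[i c] [j c'].
  by rewrite !mem_filter /= => /andP[/negbTE -> _] /andP[/negbTE -> _] ->.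
have u2 : uniq J2.
  rewrite map_inj_in_uniq ?filter_uniq// => -[i c] [j c'].
  by rewrite !mem_filter /= => /andP[-> _] /andP[-> _] ->.
have m1 i : i \in J1 -> (i, false) \in J.
  by move=> /mapP[[j c]]; rewrite mem_filter /= => /andP[/negbTE -> ?] ->.
have m2 i : i \in J2 -> (i, true) \in J.
  by move=> /mapP[[j c]]; rewrite mem_filter /= => /andP[-> ?] ->.
have m1' i : (i, false) \in J -> i \in J1.
  by move=> h; apply/mapP; exists (i, false); rewrite ?mem_filter.
have m2' i : (i, true) \in J -> i \in J2.
  by move=> h; apply/mapP; exists (i, true); rewrite ?mem_filter.
pose rect c (L : seq int) := [set s : int -> S | forall i, i \in L -> A (i, c) (s i)].
have srect c L : <<s @cylinders _ S int>> (rect c L).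
  rewrite -sigma_rectangles; apply: sub_sigma_algebra.
  by exists L, (fun i => A (i, c)); split.
have -> : [set w | forall i, i \in J -> A i (joint i w)] =
    path_of delta @^-1` rect false J1 `&` path_of delta' @^-1` rect true J2.
  apply/seteqP; split=> w /=.
    move=> h; split=> i iJ; [exact: (h _ (m1 _ iJ))|exact: (h _ (m2 _ iJ))].
  by move=> [h1 h2] [i [|]] iJ; [exact: h2 (m2' _ iJ)|exact: h1 (m1' _ iJ)].
rewrite ind// law//.
have E c L : uniq L -> P (path_of delta @^-1` rect c L) =
    (\prod_(i <- L) P (delta 0%R @^-1` A (i, c)))%E.
  move=> uL; have := id L (fun i => A (i, c)) uL (fun i => mA _).
  by move=> ->; apply: eq_bigr => i _; exact: sd.
rewrite !E// !big_map !big_filter.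
rewrite [RHS](bigID (fun i => i.2))/= muleC; congr (_ * _)%E.
  by apply: eq_bigr => -[i c] /= ->.
by apply: eq_bigr => -[i c] /= /negbTE ->.
Qed.

End joint_family.

(** * Variance of sums of approximable variables *)

Section real_integrals.
Context {R : realType} {d : measure_display} {Omega : measurableType d}.
Variable P : probability Omega R.
Implicit Types f g : Omega -> R.

Lemma ge0_integralD_EFin f g : measurable_fun setT f -> measurable_fun setT g ->
  (forall w, 0 <= f w) -> (forall w, 0 <= g w) ->
  (\int[P]_w (f w + g w)%:E = \int[P]_w (f w)%:E + \int[P]_w (g w)%:E)%E.
Proof.
move=> mf mg f0 g0.
under eq_integral do rewrite EFinD.
rewrite ge0_integralD//; try (by move=> w _; rewrite lee_fin); exact/measurable_EFinP.
Qed.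

Lemma ge0_integralM_EFin (k : R) f : 0 <= k -> measurable_fun setT f ->
  (forall w, 0 <= f w) ->
  (\int[P]_w (k * f w)%:E = k%:E * \int[P]_w (f w)%:E)%E.
Proof.
move=> k0 mf f0; under eq_integral do rewrite EFinM.
by rewrite ge0_integralZl// ?lee_fin//; [exact/measurable_EFinP|move=> w _; rewrite lee_fin].
Qed.

Lemma ge0_integral_sum_EFin (I : Type) (s : seq I) (f : I -> Omega -> R) :
  (forall i, measurable_fun setT (f i)) -> (forall i w, 0 <= f i w) ->
  (\int[P]_w (\sum_(i <- s) f i w)%:E = \sum_(i <- s) \int[P]_w (f i w)%:E)%E.
Proof.
move=> mf f0; under eq_integral do rewrite -sumEFin.
rewrite ge0_integral_sum//; first by move=> i; exact/measurable_EFinP.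
by move=> i w _; rewrite lee_fin.
Qed.

Lemma ge0_le_integral_EFin f g : measurable_fun setT f -> measurable_fun setT g ->
  (forall w, 0 <= f w) -> (forall w, f w <= g w) ->
  (\int[P]_w (f w)%:E <= \int[P]_w (g w)%:E)%E.
Proof.
move=> mf mg f0 fg; apply: ge0_le_integral => //.
- by move=> w _; rewrite lee_fin.
- exact/measurable_EFinP.
- exact/measurable_EFinP.
- by move=> w _; rewrite lee_fin.
Qed.

Lemma integrableD_EFin f g :
  P.-integrable setT (fun w => (f w)%:E) -> P.-integrable setT (fun w => (g w)%:E) ->
  P.-integrable setT (fun w => (f w + g w)%:E).
Proof.
by move=> fi gi; under eq_fun do rewrite EFinD; exact: (integrableD measurableT fi gi).
Qed.

Lemma integrableM_EFin (k : R) f : P.-integrable setT (fun w => (f w)%:E) ->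
  P.-integrable setT (fun w => (k * f w)%:E).
Proof.
by move=> fi; under eq_fun do rewrite EFinM; exact: (integrableZl measurableT k fi).
Qed.

Lemma integrable_sum_EFin (I : Type) (s : seq I) (f : I -> Omega -> R) :
  (forall i, P.-integrable setT (fun w => (f i w)%:E)) ->
  P.-integrable setT (fun w => (\sum_(i <- s) f i w)%:E).
Proof.
move=> fi; under eq_fun do rewrite -sumEFin.
by apply: (@integrable_sum _ _ _ P setT measurableT _ s xpredT (fun i w => (f i w)%:E)).
Qed.

End real_integrals.

Section square_integrable.
Context {R : realType} {d : measure_display} {Omega : measurableType d}.
Variable P : probability Omega R.

Definition sqr_integrable (U : Omega -> R) :=
  measurable_fun setT U /\ P.-integrable setT (fun w => (U w ^+ 2)%:E).

Lemma sqr_integrable_mul U V : sqr_integrable U -> sqr_integrable V ->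
  P.-integrable setT (fun w => (U w * V w)%:E).
Proof.
move=> [mU iU] [mV iV].
apply: (le_integrable measurableT _ _ (integrableD measurableT iU iV)) => //.
  by apply/measurable_EFinP; exact: measurable_funM.
move=> w _; rewrite -EFinD !abse_EFin lee_fin [leRHS]ger0_norm ?addr_ge0 ?sqr_ge0//.
have h1 := sqr_ge0 (U w - V w); have h2 := sqr_ge0 (U w + V w).
rewrite ler_norml; apply/andP; split; nra.
Qed.

Lemma sqr_integrableB U V : sqr_integrable U -> sqr_integrable V ->
  sqr_integrable (fun w => U w - V w).
Proof.
move=> sU sV; have [mU iU] := sU; have [mV iV] := sV.
have mUV : measurable_fun setT (fun w => U w - V w) by exact: measurable_funB.
split => //.
have i2 := integrableD measurableT iU iV.
apply: (le_integrable measurableT _ _ (integrableD measurableT i2 i2)) => //.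
  by apply/measurable_EFinP; exact: measurable_funX.
move=> w _; rewrite -!EFinD !abse_EFin lee_fin !ger0_norm ?addr_ge0 ?sqr_ge0//.
have h2 := sqr_ge0 (U w + V w); nra.
Qed.

Lemma sqr_integrable_integrable U : sqr_integrable U -> P.-integrable setT (EFin \o U).
Proof.
move=> [mU iU].
have i1 : P.-integrable setT (cst 1%E : Omega -> \bar R).
  by apply: finite_measure_integrable_cst.
apply: (le_integrable measurableT _ _ (integrableD measurableT i1 iU)) => //.
  by apply/measurable_EFinP.
move=> w _; rewrite [X in (_ <= `|X|)%E](_ : _ = (1 + U w ^+ 2)%:E)//.
rewrite !abse_EFin lee_fin [leRHS]ger0_norm ?addr_ge0 ?sqr_ge0//.
have h1 := sqr_ge0 (U w - 1); have h2 := sqr_ge0 (U w + 1).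
rewrite ler_norml; apply/andP; split; nra.
Qed.

End square_integrable.

Section shifts.
Context {d' : measure_display} {S : measurableType d'}.

Definition past_index (n : nat) (i : nat) : int * bool := (n%:Z - i%:Z, false).

Definition coupled_index (n m : nat) (i : nat) : int * bool :=
  (n%:Z - i%:Z, ~~ (i < m)%N).

Definition shift_index (c : int) (i : int * bool) : int * bool := (i.1 + c, i.2).

Lemma past_index_inj n : injective (past_index n).
Proof. by move=> i j [] ?; lia. Qed.

Lemma coupled_index_inj n m : injective (coupled_index n m).
Proof. by move=> i j [] ? _; lia. Qed.

Lemma shift_index_inj c : injective (shift_index c).
Proof. by move=> [i a] [j b] [] /addIr -> ->. Qed.

(** With lag [l - k], the coupled path keeps the innovations at times k + 1, ..., l and takes all
    earlier ones from the copy, while the past of [k] uses the original ones up to time k. *)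
Lemma past_coupled_disjoint k l i j : (k < l)%N ->
  past_index k i <> coupled_index l (l - k) j.
Proof. by move=> kl [] ? ?; lia. Qed.

Lemma measurable_reindex (K L : Type) (s : L -> K) :
  measurable_fun setT ((fun x => x \o s) :
    g_sigma_algebraType (@cylinders _ S K) -> g_sigma_algebraType (@cylinders _ S L)).
Proof.
apply: (@measurability _ _ (g_sigma_algebraType (@cylinders _ S K))
  (g_sigma_algebraType (@cylinders _ S L)) setT (fun x => x \o s) (@cylinders _ S L)) => //.
move=> _ [_ [l [B [mB ->]]] <-]; rewrite setTI; apply: sub_sigma_algebra.
by exists (s l), B.
Qed.

End shifts.

Section variance.
Context {R : realType} {d : measure_display} {Omega : measurableType d}.
Variable P : probability Omega R.
Context {d' : measure_display} {S : measurableType d'}.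
Variables (q : set S -> \bar R) (theta : int * bool -> Omega -> S).
Hypothesis thiid : iid_family P q theta.
Variable phi : g_sigma_algebraType (@cylinders _ S nat) -> R.
Hypothesis mphi : measurable_fun setT phi.

Definition past_val k w := phi (pathmap (theta \o past_index k) w).
Definition coupled_val l m w := phi (pathmap (theta \o coupled_index l m) w).

Lemma measurable_past_val k : measurable_fun setT (past_val k).
Proof. exact: measurableT_comp mphi (measurable_subpath thiid (past_index k)). Qed.

Lemma measurable_coupled_val l m : measurable_fun setT (coupled_val l m).
Proof. exact: measurableT_comp mphi (measurable_subpath thiid (coupled_index l m)). Qed.

Lemma past_val_law (h : R -> \bar R) k l : measurable_fun setT h ->
  (\int[P]_w h (past_val k w) = \int[P]_w h (past_val l w))%E.
Proof.
move=> mh.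
exact: (@eq_law_integral _ _ _ P _ _ (pathmap (theta \o past_index k))
  (pathmap (theta \o past_index l)) (h \o phi) (measurable_subpath thiid _)
  (measurable_subpath thiid _) (measurableT_comp mh mphi)
  (iid_subfamily_law thiid (@past_index_inj _) (@past_index_inj _))).
Qed.

Lemma coupled_val_law (h : R -> \bar R) l m k : measurable_fun setT h ->
  (\int[P]_w h (coupled_val l m w) = \int[P]_w h (past_val k w))%E.
Proof.
move=> mh.
exact: (@eq_law_integral _ _ _ P _ _ (pathmap (theta \o coupled_index l m))
  (pathmap (theta \o past_index k)) (h \o phi) (measurable_subpath thiid _)
  (measurable_subpath thiid _) (measurableT_comp mh mphi)
  (iid_subfamily_law thiid (@coupled_index_inj _ _) (@past_index_inj _))).
Qed.

(** Translating all innovations, original and copied, by the same amount carries time [m] to time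
    [l]. Approximability speaks only of time [m] with lag [m]; this extends its control to lag [m]
    at every time. *)
Lemma past_coupled_law (h : R * R -> \bar R) l m : measurable_fun setT h ->
  (\int[P]_w h (past_val l w, coupled_val l m w) =
   \int[P]_w h (past_val m w, coupled_val m m w))%E.
Proof.
move=> mh.
pose F (x : g_sigma_algebraType (@cylinders _ S (int * bool))) : \bar R :=
  h (phi (x \o past_index m), phi (x \o coupled_index m m)).
have mF : measurable_fun setT F.
  apply: measurableT_comp mh _; apply: measurable_fun_pair.
    exact: measurableT_comp mphi (measurable_reindex _).
  exact: measurableT_comp mphi (measurable_reindex _).
(* Both paths are shifts of the whole doubled family, the second by 0, so that one functional [F]
   serves for the two times. *)
have := @eq_law_integral _ _ _ P _ _ (pathmap (theta \o shift_index (l%:Z - m%:Z)))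
  (pathmap (theta \o shift_index 0)) F
  (measurable_subpath thiid _) (measurable_subpath thiid _) mF
  (iid_subfamily_law thiid (@shift_index_inj _) (@shift_index_inj _)).
rewrite /F /past_val /coupled_val => e.
have E c n : m%:Z + c = n%:Z -> forall w,
    (pathmap (theta \o shift_index c) w \o past_index m = pathmap (theta \o past_index n) w) *
    (pathmap (theta \o shift_index c) w \o coupled_index m m = pathmap (theta \o coupled_index n m) w).
  move=> cn w; split; apply/funext => i; rewrite /pathmap/= /shift_index /past_index/=;
  by congr (theta (_, _) w); rewrite addrAC cn.
have El : m%:Z + (l%:Z - m%:Z) = l%:Z by rewrite addrC subrK.
have E0 : m%:Z + 0 = m%:Z by rewrite addr0.
rewrite (eq_integral (fun w => h (phi (pathmap (theta \o past_index l) w),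
  phi (pathmap (theta \o coupled_index l m) w)))) in e; last first.
  by move=> w _; rewrite !(E _ _ El).
rewrite e; apply: eq_integral => w _; by rewrite !(E _ _ E0).
Qed.

Hypothesis phi2 : (\int[P]_w (past_val 1 w ^+ 2)%:E < +oo)%E.
Hypothesis phi0 : (\int[P]_w (past_val 1 w)%:E = 0)%E.

Let s := (\int[P]_w (past_val 1 w ^+ 2)%:E)%E.
Let t m := (\int[P]_w ((past_val m w - coupled_val m m w) ^+ 2)%:E)%E.

Let msqr : measurable_fun setT (fun x : R => (x ^+ 2)%:E : \bar R).
Proof. by apply/measurable_EFinP; exact: exprn_measurable. Qed.

Lemma past_val_sqr_integrable k : sqr_integrable P (past_val k).
Proof.
split; first exact: measurable_past_val.
apply/integrableP; split.
  exact: measurableT_comp msqr (measurable_past_val k).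
under eq_integral do rewrite gee0_abs ?lee_fin ?sqr_ge0//.
by rewrite (past_val_law k 1 msqr).
Qed.

Lemma coupled_val_sqr_integrable l m : sqr_integrable P (coupled_val l m).
Proof.
split; first exact: measurable_coupled_val.
apply/integrableP; split.
  exact: measurableT_comp msqr (measurable_coupled_val l m).
under eq_integral do rewrite gee0_abs ?lee_fin ?sqr_ge0//.
by rewrite (coupled_val_law l m 1 msqr).
Qed.

Lemma past_coupled_integral0 k l : (k < l)%N ->
  (\int[P]_w (past_val k w * coupled_val l (l - k) w)%:E = 0)%E.
Proof.
move=> kl; apply: independent_integral_mul.
- exact: measurable_past_val.
- exact: measurable_coupled_val.
- move=> A B mA mB.
  have := @iid_subfamily_independent _ _ _ P _ _ _ _ _ thiid _ _
    (past_index k) (coupled_index l (l - k)) (@past_index_inj k)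
    (@coupled_index_inj l (l - k))
    (fun i j => @past_coupled_disjoint k l i j kl) (phi @^-1` A) (phi @^-1` B).
  apply.
    by rewrite -[X in measurable X]setTI; exact: mphi.
  by rewrite -[X in measurable X]setTI; exact: mphi.
- exact: sqr_integrable_integrable (coupled_val_sqr_integrable l (l - k)).
- exact: sqr_integrable_mul (past_val_sqr_integrable k) (coupled_val_sqr_integrable l (l - k)).
- by rewrite (@coupled_val_law (fun x => x%:E) _ _ 1)//; apply/measurable_EFinP; exact: measurable_id.
Qed.

Lemma past_coupled_sqr_integrable l m :
  sqr_integrable P (fun w => past_val l w - coupled_val l m w).
Proof.
exact: sqr_integrableB (past_val_sqr_integrable l) (coupled_val_sqr_integrable l m).
Qed.

Lemma past_coupled_sqr_law l m :
  (\int[P]_w ((past_val l w - coupled_val l m w) ^+ 2)%:E = t m)%E.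
Proof.
apply: (@past_coupled_law (fun z => ((z.1 - z.2) ^+ 2)%:E)).
apply/measurable_EFinP; apply: measurable_funX; apply: measurable_funB.
  exact: measurable_fst.
exact: measurable_snd.
Qed.

(* The coupled value at time l with lag l - k is independent of the past up to
   time k, so each cross term U_k U_l may be replaced by U_k (U_l - V_(l,l-k)),
   to which AM-GM is applied. *)
Lemma variance_sum_le (r : nat -> R) n : (forall m, 0 < r m) ->
  (\int[P]_w ((\sum_(1 <= k < n.+1) past_val k w) ^+ 2)%:E <=
   n%:R%:E * (s + \sum_(1 <= m < n.+1) ((r m)%:E * s + (r m)^-1%:E * t m)))%E.
Proof.
move=> r0.
pose D l m w := past_val l w - coupled_val l m w.
(* The square of the sum is dominated by a nonnegative part [A], integrated term by term, and a part
   [B] made of products with the decoupled values, whose integral vanishes. *)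
pose A l w := past_val l w ^+ 2 + \sum_(1 <= k < l)
  (r (l - k)%N * past_val k w ^+ 2 + (r (l - k)%N)^-1 * D l (l - k)%N w ^+ 2).
pose B l w := 2 * \sum_(1 <= k < l) past_val k w * coupled_val l (l - k) w.
have pointwise w : (\sum_(1 <= k < n.+1) past_val k w) ^+ 2 <=
    \sum_(1 <= l < n.+1) A l w + \sum_(1 <= l < n.+1) B l w.
  elim: n => [|n IH]; first by rewrite !big_geq// expr0n/= addr0.
  rewrite !(@big_nat_recr _ _ _ n.+1)//= sqrrD.
  set S1 := \sum_(1 <= k < n.+1) past_val k w in IH *.
  set SA := \sum_(1 <= l < n.+1) A l w in IH *.
  set SB := \sum_(1 <= l < n.+1) B l w in IH *.
  suff h : past_val n.+1 w ^+ 2 + S1 * past_val n.+1 w *+ 2 <= A n.+1 w + B n.+1 w by lra.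
  rewrite /A /B -addrA lerD2l mulrC -mulr_natl /S1 mulr_sumr mulr_sumr mulr_sumr -big_split/=.
  apply: ler_sum_nat => k /andP[k1 kn].
  rewrite /D; set U := past_val n.+1 w; set Uk := past_val k w; set V := coupled_val _ _ _.
  set rho := r _; have rho0 : 0 < rho by exact: r0.
  (* Expanded, this is AM-GM with weight [rho], that is, 2 Uk (U - V) <= rho Uk^2 + (U - V)^2 /
     rho. *)
  have h : 0 <= (rho * Uk - (U - V)) ^+ 2 / rho by rewrite divr_ge0 ?sqr_ge0 ?ltW.
  rewrite -subr_ge0; apply: le_trans h _; rewrite le_eqVlt; apply/orP; left.
  by apply/eqP; field; rewrite gt_eqF.
have sU k := past_val_sqr_integrable k.
have sD l m : sqr_integrable P (D l m) := past_coupled_sqr_integrable l m.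
have mA l : measurable_fun setT (fun w => (A l w)%:E).
  apply/measurable_EFinP; apply: measurable_funD.
    by apply: measurable_funX; exact: measurable_past_val.
  apply: measurable_sum => k; apply: measurable_funD; apply: measurable_funM => //;
    apply: measurable_funX; [exact: measurable_past_val|by case: (sD l (l - k)%N)].
have A0 l w : (0 <= (A l w)%:E)%E.
  rewrite lee_fin addr_ge0 ?sqr_ge0//; apply: sumr_ge0 => k _.
  by rewrite addr_ge0// mulr_ge0 ?sqr_ge0// ?invr_ge0 ltW.
have mr m k c : measurable_fun setT (fun w => r m * past_val k w ^+ 2 + (r m)^-1 * D c m w ^+ 2).
  apply: measurable_funD; apply: measurable_funM => //; apply: measurable_funX.
    exact: measurable_past_val.
  by case: (sD c m).
have r0' m : 0 <= (r m)^-1 by rewrite invr_ge0 ltW.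
have intA l : (\int[P]_w (A l w)%:E = s + \sum_(1 <= k < l)
    ((r (l - k)%N)%:E * s + (r (l - k)%N)^-1%:E * t (l - k)%N))%E.
  have mX k : measurable_fun setT (fun w => past_val k w ^+ 2).
    by apply: measurable_funX; exact: measurable_past_val.
  have mD2 m : measurable_fun setT (fun w => D l m w ^+ 2).
    by apply: measurable_funX; case: (sD l m).
  rewrite ge0_integralD_EFin//; first last.
  - by move=> w; apply: sumr_ge0 => k _; rewrite addr_ge0// mulr_ge0 ?sqr_ge0// ltW.
  - by move=> w; exact: sqr_ge0.
  - by apply: measurable_sum => k.
  congr (_ + _)%E; first exact: past_val_law msqr.
  rewrite ge0_integral_sum_EFin//; last first.
    by move=> k w; rewrite addr_ge0// mulr_ge0 ?sqr_ge0// ltW.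
  apply: eq_bigr => k _; rewrite ge0_integralD_EFin//; first last.
  - by move=> w; rewrite mulr_ge0// sqr_ge0.
  - by move=> w; rewrite mulr_ge0 ?sqr_ge0// ltW.
  - exact: measurable_funM.
  - exact: measurable_funM.
  rewrite !ge0_integralM_EFin ?(ltW (r0 _))//; try by move=> w; exact: sqr_ge0.
  congr (_ * _ + _ * _)%E; first exact: past_val_law msqr.
  exact: past_coupled_sqr_law.
have iA : P.-integrable setT (fun w => (\sum_(1 <= l < n.+1) A l w)%:E).
  apply: integrable_sum_EFin => l; apply: integrableD_EFin; first by case: (sU l).
  apply: integrable_sum_EFin => k; apply: integrableD_EFin; apply: integrableM_EFin.
    by case: (sU k).
  by case: (sD l (l - k)%N).
have iUV k l : P.-integrable setT (fun w => (past_val k w * coupled_val l (l - k) w)%:E).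
  exact: sqr_integrable_mul (sU k) (coupled_val_sqr_integrable l (l - k)).
have iBl l : P.-integrable setT (fun w => (B l w)%:E).
  by apply: integrableM_EFin; apply: integrable_sum_EFin => k.
have iB : P.-integrable setT (fun w => (\sum_(1 <= l < n.+1) B l w)%:E).
  exact: integrable_sum_EFin.
have intB : (\int[P]_w (\sum_(1 <= l < n.+1) B l w)%:E = 0)%E.
  under eq_integral do rewrite -sumEFin.
  rewrite (@integral_sum _ _ _ P setT measurableT _ (fun l w => (B l w)%:E))//.
  apply: big1 => l _; rewrite /B.
  under eq_integral do rewrite EFinM.
  rewrite integralZl//; last by apply: integrable_sum_EFin => k.
  under eq_integral do rewrite -sumEFin.
  rewrite (@integral_sum _ _ _ P setT measurableT _ (fun k w => (past_val k w * coupled_val l (l - k) w)%:E))//.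
  rewrite big_nat_cond big1 ?mule0// => k /andP[/andP[_ kl] _].
  exact: past_coupled_integral0.
have mS : measurable_fun setT (fun w => (\sum_(1 <= k < n.+1) past_val k w) ^+ 2).
  by apply: measurable_funX; apply: measurable_sum => k; exact: measurable_past_val.
apply: (@le_trans _ _ (\int[P]_w (\sum_(1 <= l < n.+1) A l w + \sum_(1 <= l < n.+1) B l w)%:E)%E).
  apply: ge0_le_integral => //.
  - by move=> w _; rewrite lee_fin sqr_ge0.
  - exact/measurable_EFinP.
  - by case/integrableP: (integrableD_EFin iA iB).
  - by move=> w _; rewrite lee_fin.
under eq_integral do rewrite EFinD.
rewrite integralD//= intB adde0.
rewrite ge0_integral_sum_EFin; last 2 first.
- by move=> l; apply/measurable_EFinP; exact: mA.
- by move=> l w; rewrite -lee_fin.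
have s0 : (0 <= s)%E by apply: integral_ge0 => w _; rewrite lee_fin sqr_ge0.
have t0 m : (0 <= t m)%E by apply: integral_ge0 => w _; rewrite lee_fin sqr_ge0.
have st0 m : (0 <= (r m)%:E * s + (r m)^-1%:E * t m)%E.
  by rewrite adde_ge0// mule_ge0// lee_fin// ltW.
pose c := (s + \sum_(1 <= m < n.+1) ((r m)%:E * s + (r m)^-1%:E * t m))%E.
apply: (@le_trans _ _ (\sum_(1 <= l < n.+1) c)%E).
  rewrite [leLHS]big_nat_cond [leRHS]big_nat_cond.
  apply: lee_sum => l /andP[/andP[l1 ln] _]; rewrite intA leeD2l//.
  (* Reversal turns the times k < l into the lags l - k. The lags below [l] are then completed by
     nonnegative terms to all lags up to [n], which makes the bound the same for every [l]. *)
  rewrite big_nat_rev/=.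
  apply: (@le_trans _ _ (\sum_(1 <= m < l) ((r m)%:E * s + (r m)^-1%:E * t m))%E).
    rewrite le_eqVlt; apply/orP; left; apply/eqP.
    apply: eq_big_nat => k /andP[k1 kl].
    by rewrite (_ : l - (1 + l - k.+1) = k)%N//; lia.
  rewrite [leRHS](@big_cat_nat _ _ _ l)//=; last by rewrite ltnW.
  by rewrite leeDl//; apply: sume_ge0 => m _; exact: st0.
by rewrite sumr_const_nat subn1/= mule_natl.
Qed.

End variance.

(** * Second moments of empirical tensors *)

Section borel.
Context {R : realType} {H : completeNormedModType R}.
Local Notation borel := (g_sigma_algebraType (@open H)).

Lemma continuous_borel_measurable (h : H -> R) : continuous h ->
  measurable_fun setT (h : borel -> R).
Proof.
move=> hc; apply: (measurability _ (RGenOInfty.measurableE R)) => //.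
move=> _ [_ [x ->] <-]; rewrite setTI; apply: sub_sigma_algebra.
apply: open_comp; last exact: rray_open.
by move=> y _; exact: hc.
Qed.

Context {d : measure_display} {T : measurableType d}.

Lemma measurable_continuous_comp (h : H -> R) (Z : T -> H) : continuous h ->
  measurable_fun setT (Z : T -> borel) -> measurable_fun setT (fun w => h (Z w)).
Proof. by move=> hc mZ; exact: measurableT_comp (continuous_borel_measurable hc) mZ. Qed.

Lemma measurable_norm_borel (Z : T -> H) :
  measurable_fun setT (Z : T -> borel) -> measurable_fun setT (fun w => `|Z w|).
Proof. by apply: measurable_continuous_comp; exact: norm_continuous. Qed.

Variable (ip : {dot H for idfun}).
Hypothesis H_inner : norm_from_inner ip.

Lemma measurable_ip_borel x (Z : T -> H) :
  measurable_fun setT (Z : T -> borel) -> measurable_fun setT (fun w => ip x (Z w)).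
Proof. by apply: measurable_continuous_comp; exact: ip_continuous. Qed.

Variable b : nat -> H.
Hypothesis bb : orthonormal_basis ip b.

(** Parseval exhibits the norm as a limit of functions of the coordinates. Norms of sums and
    differences can thus be treated without showing that the sums themselves are Borel random
    elements. *)
Lemma measurable_norm_coordinates (Z : T -> H) :
  (forall i, measurable_fun setT (fun w => ip (b i) (Z w))) ->
  measurable_fun setT (fun w => `|Z w|).
Proof.
move=> mZ.
rewrite (_ : (fun w => _) = (fun w => Num.sqrt (`|Z w| ^+ 2))); last first.
  by apply/funext => w; rewrite sqrtr_sqr normr_id.
apply: (measurableT_comp (continuous_measurable_fun (@sqrt_continuous R))).
apply: (@measurable_fun_cvg _ _ _ _ (fun N w => \sum_(i < N) ip (b i) (Z w) ^+ 2)).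
  by move=> N; apply: measurable_sum => i; exact: measurable_funX.
by move=> w _; exact: (parseval H_inner).
Qed.

Lemma measurable_normB_borel (Z W : T -> H) :
  measurable_fun setT (Z : T -> borel) -> measurable_fun setT (W : T -> borel) ->
  measurable_fun setT (fun w => `|Z w - W w|).
Proof.
move=> mZ mW; apply: measurable_norm_coordinates => i.
under eq_fun do rewrite ipBr.
by apply: measurable_funB; exact: measurable_ip_borel.
Qed.

End borel.

Section second_moment.
Context {R : realType} {H : completeNormedModType R} (ip : {dot H for idfun}).
Hypothesis H_inner : norm_from_inner ip.
Variable b : nat -> H.
Hypothesis bb : orthonormal_basis ip b.
Context {d : measure_display} {Omega : measurableType d}.
Variable P : probability Omega R.
Context {d' : measure_display} {S : measurableType d'}.
Variables (q : set S -> \bar R) (theta : int * bool -> Omega -> S).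
Hypothesis thiid : iid_family P q theta.
Local Notation path := (g_sigma_algebraType (@cylinders _ S nat)).
Local Notation borel := (g_sigma_algebraType (@open H)).

(** In coordinates, the difference of tensors is (x - x') (x) y + x' (x) (y - y'). Bessel bounds
    each part by a product of squared norms, which AM-GM with weight [rho] separates into fourth
    powers. *)
Lemma sum_sqr_tensor_le N x x' y y' rho : 0 < rho ->
  \sum_(i < N) \sum_(j < N)
    (ip (b i) x * ip (b j) y - ip (b i) x' * ip (b j) y') ^+ 2 <=
  rho^-1 * `|x - x'| ^+ 4 + rho * `|y| ^+ 4 +
  (rho^-1 * `|y - y'| ^+ 4 + rho * `|x'| ^+ 4).
Proof.
move=> rho0; have bon := proj1 bb.
pose B z := \sum_(i < N) ip (b i) z ^+ 2.
have B0 z : 0 <= B z by apply: sumr_ge0 => i _; exact: sqr_ge0.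
have Ble z : B z <= `|z| ^+ 2 by exact: bessel.
apply: (@le_trans _ _ (2 * (B (x - x') * B y) + 2 * (B (y - y') * B x'))).
  rewrite [leRHS](_ : _ = \sum_(i < N) \sum_(j < N)
    (2 * (ip (b i) (x - x') ^+ 2 * ip (b j) y ^+ 2) +
     2 * (ip (b j) (y - y') ^+ 2 * ip (b i) x' ^+ 2))).
    apply: ler_sum => i _; apply: ler_sum => j _; rewrite !ipBr.
    move: (ip _ x) (ip _ x') (ip _ y) (ip _ y') => a a' c c'.
    have := sqr_ge0 ((a - a') * c - (c - c') * a'); nra.
  under [RHS]eq_bigr do rewrite big_split/= -!mulr_sumr -!mulr_suml.
  by rewrite big_split/= -!mulr_sumr -!mulr_suml.
have amgm z y0 : 2 * (B z * B y0) <= rho^-1 * `|z| ^+ 4 + rho * `|y0| ^+ 4.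
  apply: (@le_trans _ _ (2 * (`|z| ^+ 2 * `|y0| ^+ 2))).
    by rewrite ler_wpM2l// ler_pM.
  move: (`|z|) (`|y0|) => s t.
  have h : 0 <= (s ^+ 2 - rho * t ^+ 2) ^+ 2 / rho by rewrite divr_ge0 ?sqr_ge0 ?ltW.
  rewrite -subr_ge0; apply: le_trans h _; rewrite le_eqVlt; apply/orP; left.
  by apply/eqP; field; rewrite gt_eqF.
exact: lerD.
Qed.

Lemma sum_sqr_tensor_bound N x y :
  \sum_(i < N) \sum_(j < N) (ip (b i) x * ip (b j) y) ^+ 2 <=
  2^-1 * (`|x| ^+ 4 + `|y| ^+ 4).
Proof.
have bon := proj1 bb.
under eq_bigr => i _ do (under eq_bigr do rewrite exprMn; rewrite -mulr_sumr).
rewrite -mulr_suml.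
apply: (@le_trans _ _ (`|x| ^+ 2 * `|y| ^+ 2)).
  by apply: ler_pM; rewrite ?bessel//; apply: sumr_ge0 => i _; exact: sqr_ge0.
move: (`|x|) (`|y|) => s t; have := sqr_ge0 (s ^+ 2 - t ^+ 2); nra.
Qed.

Variables (f g : path -> H).
Hypotheses (mf : measurable_fun setT (f : path -> borel))
  (mg : measurable_fun setT (g : path -> borel)).

Let past k : Omega -> path := pathmap (theta \o past_index k).
Let coupled l m : Omega -> path := pathmap (theta \o coupled_index l m).

Variables (F G : R) (r : nat -> R).
Hypothesis fF : (\int[P]_w (`|f (past 1 w)| ^+ 4)%:E <= F%:E)%E.
Hypothesis gG : (\int[P]_w (`|g (past 1 w)| ^+ 4)%:E <= G%:E)%E.
Hypothesis r0 : forall m, 0 < r m.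
Hypothesis fr : forall m, (0 < m)%N ->
  (\int[P]_w (`|f (past m w) - f (coupled m m w)| ^+ 4)%:E <= (r m ^+ 4)%:E)%E.
Hypothesis gr : forall m, (0 < m)%N ->
  (\int[P]_w (`|g (past m w) - g (coupled m m w)| ^+ 4)%:E <= (r m ^+ 4)%:E)%E.
Variable c : nat -> nat -> R.

Let phi i j (x : path) := ip (b i) (f x) * ip (b j) (g x) - c i j.
Hypothesis phi0 : forall i j, (\int[P]_w (phi i j (past 1 w))%:E = 0)%E.

Let mip_f i : measurable_fun setT (fun x => ip (b i) (f x)).
Proof. exact: measurable_ip_borel. Qed.

Let mip_g j : measurable_fun setT (fun x => ip (b j) (g x)).
Proof. exact: measurable_ip_borel. Qed.

Let mphi i j : measurable_fun setT (phi i j).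
Proof. by apply: measurable_funB => //; exact: measurable_funM. Qed.

Let mpast k : measurable_fun setT (past k).
Proof. by have h := measurable_subpath thiid (past_index k); exact: h. Qed.

Let mcoupled l m : measurable_fun setT (coupled l m).
Proof. by have h := measurable_subpath thiid (coupled_index l m); exact: h. Qed.

Let mnf k : measurable_fun setT (fun w => `|f (past k w)| ^+ 4).
Proof.
apply: measurable_funX; apply: measurable_norm_borel.
exact: measurableT_comp mf (mpast k).
Qed.

Let mng k : measurable_fun setT (fun w => `|g (past k w)| ^+ 4).
Proof.
apply: measurable_funX; apply: measurable_norm_borel.
exact: measurableT_comp mg (mpast k).
Qed.

Let u := 2^-1 * (F + G).

Let prod_sqr_le N :
  (\int[P]_w (\sum_(i < N) \sum_(j < N)
     (ip (b i) (f (past 1 w)) * ip (b j) (g (past 1 w))) ^+ 2)%:E <= u%:E)%E.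
Proof.
apply: (@le_trans _ _ (\int[P]_w (2^-1 * (`|f (past 1 w)| ^+ 4 + `|g (past 1 w)| ^+ 4))%:E)%E).
  apply: ge0_le_integral_EFin.
  - apply: measurable_sum => i; apply: measurable_sum => j; apply: measurable_funX.
    by apply: measurable_funM; [exact: measurableT_comp (mip_f i) (mpast 1)|
      exact: measurableT_comp (mip_g j) (mpast 1)].
  - by apply: measurable_funM => //; exact: measurable_funD.
  - by move=> w; apply: sumr_ge0 => i _; apply: sumr_ge0 => j _; exact: sqr_ge0.
  - by move=> w; exact: sum_sqr_tensor_bound.
rewrite ge0_integralM_EFin//; last exact: measurable_funD.
rewrite ge0_integralD_EFin// /u EFinM EFinD.
by rewrite lee_pmul2l// leeD.
Qed.

Let prod_sqr_integrable i j : sqr_integrable P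
  (fun w => ip (b i) (f (past 1 w)) * ip (b j) (g (past 1 w))).
Proof.
have m1 k l : measurable_fun setT (fun w => ip (b k) (f (past 1 w)) * ip (b l) (g (past 1 w))).
  by apply: measurable_funM; [exact: measurableT_comp (mip_f k) (mpast 1)|
      exact: measurableT_comp (mip_g l) (mpast 1)].
split=> //; apply/integrableP; split.
  by apply/measurable_EFinP; exact: measurable_funX.
under eq_integral do rewrite gee0_abs ?lee_fin ?sqr_ge0//.
apply: le_lt_trans (ltry u); apply: le_trans (prod_sqr_le (maxn i j).+1).
apply: ge0_le_integral_EFin.
- exact: measurable_funX.
- by apply: measurable_sum => k; apply: measurable_sum => l; exact: measurable_funX.
- by move=> w; exact: sqr_ge0.
move=> w.
have ii : (i < (maxn i j).+1)%N by rewrite ltnS leq_maxl.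
have jj : (j < (maxn i j).+1)%N by rewrite ltnS leq_maxr.
rewrite (bigD1 (Ordinal ii))//= (bigD1 (Ordinal jj))//= -addrA lerDl.
rewrite addr_ge0//; last (apply: sumr_ge0 => k _); by apply: sumr_ge0 => l _; exact: sqr_ge0.
Qed.

(** Centering lowers the second moment: with X the uncentered product, phi^2 = X^2 - 2 c phi - c^2,
    and phi has mean zero. *)
Let phi_sqr_le i j :
  (\int[P]_w (past_val theta (phi i j) 1 w ^+ 2)%:E <=
   \int[P]_w ((ip (b i) (f (past 1 w)) * ip (b j) (g (past 1 w))) ^+ 2)%:E)%E.
Proof.
pose X w := ip (b i) (f (past 1 w)) * ip (b j) (g (past 1 w)).
have [mX iX2] : sqr_integrable P X := prod_sqr_integrable i j.
have iX := sqr_integrable_integrable (prod_sqr_integrable i j).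
have icst : P.-integrable setT (fun _ : Omega => (- c i j)%:E).
  exact: finite_measure_integrable_cst.
have iphi : P.-integrable setT (fun w => (phi i j (past 1 w))%:E).
  exact: (integrableD_EFin iX icst).
apply: (@le_trans _ _ (\int[P]_w (X w ^+ 2 + (- (2 * c i j)) * phi i j (past 1 w))%:E)%E).
  apply: ge0_le_integral => //.
  - by move=> w _; rewrite lee_fin sqr_ge0.
  - apply/measurable_EFinP; apply: measurable_funX.
    exact: (measurable_past_val thiid (mphi i j)).
  - by case/integrableP: (integrableD_EFin iX2 (integrableM_EFin (- (2 * c i j)) iphi)).
  - move=> w _; rewrite lee_fin /past_val /phi -/(past 1 w) -/(X w).
    have := sqr_ge0 (c i j); nra.
under eq_integral do rewrite EFinD.
rewrite integralD//; last exact: integrableM_EFin.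
under [X in (_ + X)%E]eq_integral do rewrite EFinM.
by rewrite integralZl// phi0 mule0 adde0.
Qed.

Let phi_sqr_lty i j : (\int[P]_w (past_val theta (phi i j) 1 w ^+ 2)%:E < +oo)%E.
Proof.
apply: le_lt_trans (phi_sqr_le i j) _.
have [_ /integrableP[_]] := prod_sqr_integrable i j.
by under eq_integral do rewrite gee0_abs ?lee_fin ?sqr_ge0//.
Qed.

Let sum_phi_sqr_le N :
  (\sum_(i < N) \sum_(j < N) \int[P]_w (past_val theta (phi i j) 1 w ^+ 2)%:E <= u%:E)%E.
Proof.
apply: le_trans (prod_sqr_le N).
have m1 k l : measurable_fun setT (fun w =>
    (ip (b k) (f (past 1 w)) * ip (b l) (g (past 1 w))) ^+ 2).
  apply: measurable_funX.
  by apply: measurable_funM; [exact: measurableT_comp (mip_f k) (mpast 1)|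
      exact: measurableT_comp (mip_g l) (mpast 1)].
rewrite ge0_integral_sum_EFin; last 2 first.
- by move=> i; apply: measurable_sum => j.
- by move=> i w; apply: sumr_ge0 => j _; exact: sqr_ge0.
apply: lee_sum => i _; rewrite ge0_integral_sum_EFin//; last first.
  by move=> j w; exact: sqr_ge0.
by apply: lee_sum => j _; exact: phi_sqr_le.
Qed.

Let sum_lag_sqr_le N m : (0 < m)%N ->
  (\sum_(i < N) \sum_(j < N) \int[P]_w
     ((past_val theta (phi i j) m w - coupled_val theta (phi i j) m m w) ^+ 2)%:E
   <= (r m ^+ 2 * (2 + (F + G)))%:E)%E.
Proof.
move=> m0.
have m1 i j : measurable_fun setT (fun w =>
    (past_val theta (phi i j) m w - coupled_val theta (phi i j) m m w) ^+ 2).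
  apply: measurable_funX; apply: measurable_funB.
    exact: (measurable_past_val thiid (mphi i j)).
  exact: (measurable_coupled_val thiid (mphi i j)).
have mfc : measurable_fun setT (fun w => `|f (coupled m m w)| ^+ 4).
  apply: measurable_funX; apply: measurable_norm_borel.
  exact: measurableT_comp mf (mcoupled m m).
have mfd : measurable_fun setT (fun w => `|f (past m w) - f (coupled m m w)| ^+ 4).
  apply: measurable_funX; apply: (measurable_normB_borel H_inner bb).
    exact: measurableT_comp mf (mpast m).
  exact: measurableT_comp mf (mcoupled m m).
have mgd : measurable_fun setT (fun w => `|g (past m w) - g (coupled m m w)| ^+ 4).
  apply: measurable_funX; apply: (measurable_normB_borel H_inner bb).
    exact: measurableT_comp mg (mpast m).
  exact: measurableT_comp mg (mcoupled m m).
(* This weight balances the two kinds of terms: [rho^-1] times the fourth moment of an error, at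
   most [r m ^+ 4], and [rho] times a bounded fourth moment are both of order [r m ^+ 2]. *)
pose rho := r m ^+ 2; have rho0 : 0 < rho by rewrite exprn_gt0.
have irho0 : 0 <= rho^-1 by rewrite invr_ge0 ltW.
apply: (@le_trans _ _ (\int[P]_w (
  (rho^-1 * `|f (past m w) - f (coupled m m w)| ^+ 4 + rho * `|g (past m w)| ^+ 4) +
  (rho^-1 * `|g (past m w) - g (coupled m m w)| ^+ 4 + rho * `|f (coupled m m w)| ^+ 4))%:E)%E).
  rewrite (eq_bigr (fun i : 'I_N => \int[P]_w (\sum_(j < N)
    (past_val theta (phi i j) m w - coupled_val theta (phi i j) m m w) ^+ 2)%:E)%E); last first.
    by move=> i _; rewrite ge0_integral_sum_EFin// => j w; exact: sqr_ge0.
  rewrite -ge0_integral_sum_EFin; last 2 first.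
  - by move=> i; apply: measurable_sum => j.
  - by move=> i w; apply: sumr_ge0 => j _; exact: sqr_ge0.
  apply: ge0_le_integral_EFin.
  - by apply: measurable_sum => i; apply: measurable_sum => j.
  - by apply: measurable_funD; apply: measurable_funD; exact: measurable_funM.
  - by move=> w; apply: sumr_ge0 => i _; apply: sumr_ge0 => j _; exact: sqr_ge0.
  move=> w.
  apply: le_trans (sum_sqr_tensor_le N _ _ _ _ rho0).
  rewrite le_eqVlt; apply/orP; left; apply/eqP.
  apply: eq_bigr => i _; apply: eq_bigr => j _; congr (_ ^+ 2).
  by rewrite /past_val /coupled_val /phi; ring.
have pos k w (h : Omega -> H) : 0 <= k -> 0 <= k * `|h w| ^+ 4 by move=> k0; rewrite mulr_ge0.
rewrite ge0_integralD_EFin; first last.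
- by move=> w; rewrite addr_ge0// mulr_ge0// ltW.
- by move=> w; rewrite addr_ge0// mulr_ge0// ltW.
- by apply: measurable_funD; exact: measurable_funM.
- by apply: measurable_funD; exact: measurable_funM.
rewrite !ge0_integralD_EFin; try (by move=> w; rewrite mulr_ge0// ltW); try exact: measurable_funM.
rewrite !ge0_integralM_EFin// ?(ltW rho0)//.
have x4 : measurable_fun setT (fun x : R => (x ^+ 4)%:E : \bar R).
  by apply/measurable_EFinP; exact: exprn_measurable.
have e1 : (\int[P]_w (`|g (past m w)| ^+ 4)%:E <= G%:E)%E.
  apply: le_trans gG.
  by rewrite (@past_val_law _ _ _ P _ _ _ _ thiid _ (measurable_norm_borel mg) _ m 1 x4).
have e2 : (\int[P]_w (`|f (coupled m m w)| ^+ 4)%:E <= F%:E)%E.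
  apply: le_trans fF.
  by rewrite (@coupled_val_law _ _ _ P _ _ _ _ thiid _ (measurable_norm_borel mf) _ m m 1 x4).
apply: (@le_trans _ _ ((rho^-1)%:E * (r m ^+ 4)%:E + rho%:E * G%:E +
  ((rho^-1)%:E * (r m ^+ 4)%:E + rho%:E * F%:E))%E).
  by apply: leeD; apply: leeD; apply: lee_wpmul2l; rewrite ?lee_fin ?(ltW rho0)//; [exact: fr|exact: gr].
rewrite -!EFinM -!EFinD lee_fin le_eqVlt; apply/orP; left; apply/eqP.
by rewrite /rho; field; rewrite gt_eqF.
Qed.

(** The weights [r m] do not depend on (i, j), so the scalar variance bounds can be summed over the
    coordinates. The lag terms total O([r m ^+ 2]) and are divided by [r m]. The bound is uniform in
    [N], hence one for the full Hilbert-Schmidt norm. *)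
Lemma tensor_second_moment n N :
  (\int[P]_w (\sum_(i < N) \sum_(j < N)
     (\sum_(1 <= k < n.+1) phi i j (past k w)) ^+ 2)%:E <=
   (n%:R * (u + \sum_(1 <= m < n.+1) r m * (u + (2 + (F + G)))))%:E)%E.
Proof.
pose s i j := fine (\int[P]_w (past_val theta (phi i j) 1 w ^+ 2)%:E).
have sE i j : ((s i j)%:E = \int[P]_w (past_val theta (phi i j) 1 w ^+ 2)%:E)%E.
  rewrite fineK// ge0_fin_numE//.
  by apply: integral_ge0 => w _; rewrite lee_fin sqr_ge0.
pose t m i j := fine (\int[P]_w
     ((past_val theta (phi i j) m w - coupled_val theta (phi i j) m m w) ^+ 2)%:E).
have tE m i j : ((t m i j)%:E = \int[P]_w
     ((past_val theta (phi i j) m w - coupled_val theta (phi i j) m m w) ^+ 2)%:E)%E.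
  rewrite fineK// ge0_fin_numE; last by apply: integral_ge0 => w _; rewrite lee_fin sqr_ge0.
  have [_ /integrableP[_]] := past_coupled_sqr_integrable thiid (mphi i j) (phi_sqr_lty i j) m m.
  by under eq_integral do rewrite gee0_abs ?lee_fin ?sqr_ge0//.
have mS i j : measurable_fun setT (fun w => (\sum_(1 <= k < n.+1) phi i j (past k w)) ^+ 2).
  apply: measurable_funX; apply: measurable_sum => k.
  exact: measurableT_comp (mphi i j) (mpast k).
rewrite ge0_integral_sum_EFin; last 2 first.
- by move=> i; apply: measurable_sum => j.
- by move=> i w; apply: sumr_ge0 => j _; exact: sqr_ge0.
apply: (@le_trans _ _ (\sum_(i < N) \sum_(j < N)
  (n%:R * (s i j + \sum_(1 <= m < n.+1) (r m * s i j + (r m)^-1 * t m i j)))%:E)%E).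
  apply: lee_sum => i _; rewrite ge0_integral_sum_EFin//; last first.
    by move=> j w; exact: sqr_ge0.
  apply: lee_sum => j _.
  have := variance_sum_le thiid (mphi i j) (phi_sqr_lty i j) (phi0 i j) n r0.
  rewrite -sE; under [X in (_ <= _ * (_ + X))%E]eq_bigr do rewrite -tE -!EFinM -EFinD.
  by rewrite sumEFin -EFinD -EFinM.
under eq_bigr do rewrite sumEFin.
rewrite sumEFin lee_fin.
under eq_bigr do rewrite -mulr_sumr; rewrite -mulr_sumr ler_wpM2l//.
under eq_bigr do rewrite big_split/=; rewrite big_split/= lerD//.
  rewrite -lee_fin -sumEFin; apply: le_trans (sum_phi_sqr_le N).
  by apply: lee_sum => i _; rewrite -sumEFin; apply: lee_sum => j _; rewrite sE.
under eq_bigr do rewrite exchange_big/=; rewrite exchange_big/=.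
apply: ler_sum_nat => m /andP[m0 _].
under eq_bigr do rewrite big_split/= -!mulr_sumr; rewrite big_split/= -!mulr_sumr.
rewrite mulrDr lerD// ?ler_pM2l//.
  rewrite -lee_fin -sumEFin; apply: le_trans (sum_phi_sqr_le N).
  by apply: lee_sum => i _; rewrite -sumEFin; apply: lee_sum => j _; rewrite sE.
rewrite mulrC ler_pdivrMr// mulrAC -expr2.
rewrite -lee_fin -sumEFin; apply: le_trans (sum_lag_sqr_le N m0).
by apply: lee_sum => i _; rewrite -sumEFin; apply: lee_sum => j _; rewrite tE.
Qed.

End second_moment.

(** * Tail probabilities of empirical tensors *)

Section tail.
Context {R : realType} {H : completeNormedModType R} (ip : {dot H for idfun}).
Hypothesis H_inner : norm_from_inner ip.
Variable b : nat -> H.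
Hypothesis bb : orthonormal_basis ip b.
Context {d : measure_display} {Omega : measurableType d}.
Variable P : probability Omega R.
Local Notation borel := (g_sigma_algebraType (@open H)).

Lemma nu4_le (Z : Omega -> H) (r : R) : 0 <= r -> (nu P 4 Z <= r%:E)%E ->
  (\int[P]_w (`|Z w| ^+ 4)%:E <= (r ^+ 4)%:E)%E.
Proof.
move=> r0 h.
have n4 : (4 : R) != 0 by rewrite pnatr_eq0.
have := powR_Lnorm P (fun w => (`|Z w|)%:E) n4.
under eq_integral do rewrite abse_EFin normr_id poweR_EFin powR_mulrn//.
move=> <-; rewrite -powR_mulrn// -poweR_EFin.
by apply: gt0_ler_poweR => //; rewrite in_itv/= leey andbT ?Lnorm_ge0 ?lee_fin.
Qed.

Lemma markov_EFin (g : Omega -> R) (t B : R) : measurable_fun setT g ->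
  (forall w, 0 <= g w) -> 0 < t -> (\int[P]_w (g w)%:E <= B%:E)%E ->
  (P [set w | (t < g w)%R] <= (B / t)%:E)%E.
Proof.
move=> mg g0 t0 gB.
have mE : measurable [set w | t < g w].
  have := mg measurableT _ (measurable_itv `]t, +oo[).
  rewrite setTI; congr measurable; apply/seteqP; split=> w /=.
    by rewrite in_itv/= andbT.
  by rewrite in_itv/= andbT.
have fP : P [set w | t < g w] \is a fin_num by exact: fin_num_measure.
rewrite -(fineK fP) lee_fin ler_pdivlMr// -lee_fin EFinM fineK//.
apply: le_trans gB; rewrite muleC.
rewrite -[X in (_ * P X)%E]setIT -integral_indic// -ge0_integralZl//; last 2 first.
- by apply/measurable_EFinP; exact: measurable_indic.
- by rewrite lee_fin ltW.
apply: ge0_le_integral => //.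
- by move=> w _; rewrite mule_ge0// lee_fin// ltW.
- by apply: measurable_funeM; apply/measurable_EFinP; exact: measurable_indic.
- exact/measurable_EFinP.
move=> w _; rewrite -EFinM lee_fin indicE.
by case: (boolP (w \in _)) => [|_]; rewrite ?mulr0// inE mulr1 => /ltW.
Qed.

Context {d' : measure_display} {S : measurableType d'}.
Variables (delta delta' : int -> Omega -> S).
Hypotheses (d_iid : iid P delta) (d_copy : independent_copy P delta delta').
Local Notation path := (g_sigma_algebraType (@cylinders _ S nat)).

Let theta := joint delta delta'.
Let thiid : iid_family P _ theta := joint_iid d_iid d_copy.
Let past k : Omega -> path := pathmap (theta \o past_index k).
Let coupled l m : Omega -> path := pathmap (theta \o coupled_index l m).

Lemma coupled_pastE l m w : coupled_past delta delta' l m w = coupled l m w.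
Proof.
apply/funext => i; rewrite /coupled_past /coupled /pathmap/= /theta /joint/=.
by case: ifP.
Qed.

Let mpast k : measurable_fun setT (past k).
Proof. by have h := measurable_subpath thiid (past_index k); exact: h. Qed.

Let mcoupled l m : measurable_fun setT (coupled l m).
Proof. by have h := measurable_subpath thiid (coupled_index l m); exact: h. Qed.

(** The process is exchanged for its almost surely equal representation in the innovations, and the
    extended-real series for real coefficients [p m] with bounded partial sums. *)
Lemma approximable_bounds (Z : nat -> Omega -> H) f :
  Lp_m_approximable P 4 Z f delta delta' ->
  exists F p M, [/\ (\int[P]_w (`|f (past 1 w)| ^+ 4)%:E <= F%:E)%E,
    forall m, 0 <= p m,
    forall m, (0 < m)%N ->
      (\int[P]_w (`|f (past m w) - f (coupled m m w)| ^+ 4)%:E <= (p m ^+ 4)%:E)%E &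
    forall n, \sum_(1 <= m < n.+1) p m <= M].
Proof.
move=> [mf ZL Zf Zs].
have mfp k : measurable_fun setT ((fun w => f (past k w)) : Omega -> borel).
  exact: measurableT_comp mf (mpast k).
have mfc k : measurable_fun setT ((fun w => f (coupled k k w)) : Omega -> borel).
  exact: measurableT_comp mf (mcoupled k k).
pose nm m := nu P 4 (fun w => (Z m w - f (coupled_past delta delta' m m w))%R).
have nm0 m : (0 <= nm m)%E by exact: Lnorm_ge0.
have sum_le n : (\sum_(1 <= m < n.+1) nm m <= \sum_(1 <= m <oo) nm m)%E.
  by apply: nneseries_lim_ge => i _ _.
have nmfin m : (0 < m)%N -> nm m \is a fin_num.
  move=> m0; rewrite ge0_fin_numE//; apply: le_lt_trans Zs.
  apply: le_trans (sum_le m); rewrite big_nat_recr//= leeDr//.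
  by apply: sume_ge0 => i _.
have [Z1m Z1n] := ZL 1%N isT.
have Z1fin : nu P 4 (Z 1%N) \is a fin_num by rewrite ge0_fin_numE// Lnorm_ge0.
exists (fine (nu P 4 (Z 1%N)) ^+ 4), (fun m => fine (nm m)), (fine (\sum_(1 <= m <oo) nm m)); split.
- rewrite (@ge0_ae_eq_integral _ _ _ P setT _ (fun w => (`|Z 1%N w| ^+ 4)%:E))//.
  + by apply: nu4_le; [exact: fine_ge0 (Lnorm_ge0 _ _ _)|rewrite fineK].
  + by apply/measurable_EFinP; apply: measurable_funX; exact: measurable_norm_borel.
  + by apply/measurable_EFinP; apply: measurable_funX; exact: measurable_norm_borel.
  + by apply: filterS (Zf 1%N isT) => w e _ /=; rewrite e.
- by move=> m; exact: fine_ge0.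
- move=> m m0.
  have [Zmm _] := ZL m m0.
  rewrite (@ge0_ae_eq_integral _ _ _ P setT _
    (fun w => (`|Z m w - f (coupled_past delta delta' m m w)| ^+ 4)%:E))//.
  + by apply: nu4_le; [exact: fine_ge0|rewrite fineK// nmfin].
  + by apply/measurable_EFinP; apply: measurable_funX; exact: (measurable_normB_borel H_inner bb).
  + apply/measurable_EFinP; apply: measurable_funX; apply: (measurable_normB_borel H_inner bb) => //.
    by under eq_fun do rewrite coupled_pastE; exact: mfc.
  + by apply: filterS (Zf m m0) => w e _ /=; rewrite e coupled_pastE.
- move=> n; rewrite -lee_fin fineK; last first.
    rewrite ge0_fin_numE//; apply: nneseries_ge0 => i _ _; exact: nm0.
  apply: le_trans (sum_le n); rewrite -sumEFin [leLHS]big_nat_cond [leRHS]big_nat_cond.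
  by apply: lee_sum => m /andP[/andP[m0 _] _]; rewrite fineK// nmfin.
Qed.

Lemma sum_half_pow_le n : \sum_(1 <= m < n.+1) (2^-1 : R) ^+ m <= 1.
Proof.
suff -> : \sum_(1 <= m < n.+1) (2^-1 : R) ^+ m = 1 - 2^-1 ^+ n.
  by rewrite gerBl exprn_ge0.
elim: n => [|n IH]; first by rewrite big_geq// expr0 subrr.
by rewrite big_nat_recr//= IH exprS; field.
Qed.

(** The event lets some truncation exceed the threshold, so its complement bounds all truncations at
    once. Markov's bound is uniform in [N] and survives the increasing union by continuity from
    below. The threshold carries the factor [n%:R] because the sums over k are not yet averaged. *)
Lemma tensor_tail_bound (X W : nat -> Omega -> H) f g (c : nat -> nat -> R) :
  Lp_m_approximable P 4 X f delta delta' ->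
  Lp_m_approximable P 4 W g delta delta' ->
  (forall i j, (\int[P]_w (ip (b i) (X 1%N w) * ip (b j) (W 1%N w) - c i j)%:E = 0)%E) ->
  exists2 A, 0 <= A & forall n h, (0 < n)%N -> 0 < h ->
    let E := [set w | exists N, (n%:R * h) ^+ 2 < \sum_(i < N) \sum_(j < N)
      (\sum_(1 <= k < n.+1) (ip (b i) (X k w) * ip (b j) (W k w) - c i j)) ^+ 2] in
    measurable E /\ (P E <= (A / (n%:R * h ^+ 2))%:E)%E.
Proof.
move=> aX aW c0.
have [F [p [M1 [fF p0 fp pM]]]] := approximable_bounds aX.
have [G [p' [M2 [gG p'0 gp pM']]]] := approximable_bounds aW.
case: aX => mf XL Xf _; case: aW => mg WL Wg _.
(* One weight serves both processes. The summand [2^-1 ^+ m] keeps it positive, as its inverse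
   requires, and adds at most 1 to its sum, whence the [M1 + M2 + 1] in [A]. *)
pose r m := p m + p' m + 2^-1 ^+ m.
have hp m : 0 < (2^-1 : R) ^+ m by rewrite exprn_gt0// invr_gt0.
have r0 m : 0 < r m by rewrite ltr_wpDl// addr_ge0.
have pow4 x y : 0 <= x -> x <= y -> ((x ^+ 4)%:E <= (y ^+ 4)%:E :> \bar R)%E.
  by move=> x0 xy; rewrite lee_fin lerXn2r// nnegrE// (le_trans x0).
have fr m : (0 < m)%N ->
    (\int[P]_w (`|f (past m w) - f (coupled m m w)| ^+ 4)%:E <= (r m ^+ 4)%:E)%E.
  move=> m0; apply: le_trans (fp m m0) (pow4 _ _ (p0 m) _).
  by rewrite /r -addrA lerDl addr_ge0// ltW.
have gr m : (0 < m)%N ->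
    (\int[P]_w (`|g (past m w) - g (coupled m m w)| ^+ 4)%:E <= (r m ^+ 4)%:E)%E.
  move=> m0; apply: le_trans (gp m m0) (pow4 _ _ (p'0 m) _).
  by rewrite /r addrAC lerDr addr_ge0// ltW.
have mX k i : (0 < k)%N -> measurable_fun setT (fun w => ip (b i) (X k w)).
  by move=> k0; apply: measurable_ip_borel => //; case: (XL k k0).
have mW k i : (0 < k)%N -> measurable_fun setT (fun w => ip (b i) (W k w)).
  by move=> k0; apply: measurable_ip_borel => //; case: (WL k k0).
have mfp k i : measurable_fun setT (fun w => ip (b i) (f (past k w))).
  by apply: measurable_ip_borel => //; exact: measurableT_comp mf (mpast k).
have mgp k i : measurable_fun setT (fun w => ip (b i) (g (past k w))).
  by apply: measurable_ip_borel => //; exact: measurableT_comp mg (mpast k).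
have phi0 i j : (\int[P]_w (ip (b i) (f (past 1 w)) * ip (b j) (g (past 1 w)) - c i j)%:E = 0)%E.
  rewrite -(c0 i j); apply: ae_eq_integral => //.
  - by apply/measurable_EFinP; apply: measurable_funB => //; exact: measurable_funM.
  - apply/measurable_EFinP; apply: measurable_funB => //.
    by apply: measurable_funM; [exact: mX|exact: mW].
  - by apply: filterS2 (Xf 1%N isT) (Wg 1%N isT) => w e1 e2 _; rewrite e1 e2.
have TM := tensor_second_moment H_inner bb thiid mf mg fF gG r0 fr gr phi0.
have F0 : 0 <= F.
  by rewrite -lee_fin; apply: le_trans fF; apply: integral_ge0 => w _; rewrite lee_fin.
have G0 : 0 <= G.
  by rewrite -lee_fin; apply: le_trans gG; apply: integral_ge0 => w _; rewrite lee_fin.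
have u0 : 0 <= 2^-1 * (F + G) by rewrite mulr_ge0// addr_ge0.
have v0 : 0 <= 2^-1 * (F + G) + (2 + (F + G)) by rewrite !addr_ge0.
have M10 : 0 <= M1 by apply: le_trans (pM 0%N); rewrite big_geq.
have M20 : 0 <= M2 by apply: le_trans (pM' 0%N); rewrite big_geq.
pose A := 2^-1 * (F + G) + (M1 + M2 + 1) * (2^-1 * (F + G) + (2 + (F + G))).
exists A; first by rewrite addr_ge0// mulr_ge0// !addr_ge0.
move=> n h n0 h0.
have nr0 : 0 < n%:R :> R by rewrite ltr0n.
pose Q N w := \sum_(i < N) \sum_(j < N)
      (\sum_(1 <= k < n.+1) (ip (b i) (X k w) * ip (b j) (W k w) - c i j)) ^+ 2.
have mQ N : measurable_fun setT (Q N).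
  apply: measurable_sum => i; apply: measurable_sum => j; apply: measurable_funX.
  under eq_fun do rewrite big_add1/=.
  apply: measurable_sum => k.
  apply: measurable_funB => //; apply: measurable_funM; [exact: mX|exact: mW].
have Q0 N w : 0 <= Q N w.
  by apply: sumr_ge0 => i _; apply: sumr_ge0 => j _; exact: sqr_ge0.
have intQ N : (\int[P]_w (Q N w)%:E <= (n%:R * A)%:E)%E.
  apply: (@le_trans _ _ (n%:R * (2^-1 * (F + G) +
      \sum_(1 <= m < n.+1) r m * (2^-1 * (F + G) + (2 + (F + G)))))%:E); last first.
    rewrite lee_fin ler_pM2l// /A lerD2l -mulr_suml ler_wpM2r//.
    by rewrite !big_split/=; apply: lerD; [apply: lerD|exact: sum_half_pow_le].
  apply: le_trans (TM n N).
  rewrite le_eqVlt; apply/orP; left; apply/eqP; apply: ge0_ae_eq_integral => //.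
  - exact/measurable_EFinP.
  - apply/measurable_EFinP; apply: measurable_sum => i; apply: measurable_sum => j.
    apply: measurable_funX; apply: measurable_sum => k.
    by apply: measurable_funB => //; apply: measurable_funM; [exact: mfp|exact: mgp].
  - by move=> w _; rewrite lee_fin.
  - by move=> w _; rewrite lee_fin; apply: sumr_ge0 => i _; apply: sumr_ge0 => j _; exact: sqr_ge0.
  have aeX : {ae P, forall w, forall k, (0 < k)%N -> X k w = f (past k w)}.
    apply: ae_foralln => -[|k]; first exact: aeW.
    by apply: filterS (Xf k.+1 isT).
  have aeW' : {ae P, forall w, forall k, (0 < k)%N -> W k w = g (past k w)}.
    apply: ae_foralln => -[|k]; first exact: aeW.
    by apply: filterS (Wg k.+1 isT).
  apply: filterS2 aeX aeW' => w eX eW _; congr (_%:E); rewrite /Q.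
  apply: eq_bigr => i _; apply: eq_bigr => j _; congr (_ ^+ 2).
  by apply: eq_big_nat => k /andP[k0 _]; rewrite eX// eW.
pose EN N := [set w | (n%:R * h) ^+ 2 < Q N w].
have t0 : 0 < (n%:R * h) ^+ 2 by rewrite exprn_gt0// mulr_gt0.
have mEN N : measurable (EN N).
  have := mQ N measurableT _ (measurable_itv `]((n%:R * h) ^+ 2), +oo[).
  rewrite setTI; congr measurable; apply/seteqP; split=> w /=.
    by rewrite in_itv/= andbT.
  by rewrite in_itv/= andbT.
have PEN N : (P (EN N) <= (A / (n%:R * h ^+ 2))%:E)%E.
  have := markov_EFin (mQ N) (Q0 N) t0 (intQ N).
  congr (_ <= _%:E)%E.
  by rewrite exprMn; field; rewrite !gt_eqF.
have -> : [set w | exists N, (n%:R * h) ^+ 2 < Q N w] = \bigcup_N EN N.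
  by apply/seteqP; split=> w [N]; [exists N|move=> _ ?; exists N].
have mE : measurable (\bigcup_N EN N) by exact: bigcupT_measurable.
split=> //.
have ndE : nondecreasing_seq EN.
  apply/nondecreasing_seqP => N; apply/subsetPset => w; rewrite /EN/= => /lt_le_trans; apply.
  rewrite /Q big_ord_recr/=.
  apply: (@le_trans _ _ (\sum_(i < N) \sum_(j < N.+1)
     (\sum_(1 <= k < n.+1) (ip (b i) (X k w) * ip (b j) (W k w) - c i j)) ^+ 2)).
    by apply: ler_sum => i _; rewrite [leRHS]big_ord_recr/= lerDl sqr_ge0.
  by rewrite lerDl; apply: sumr_ge0 => j _; exact: sqr_ge0.
have cv := @nondecreasing_cvg_mu _ _ _ P EN mEN mE ndE.
rewrite -(cvg_lim _ cv)//; apply: lime_le; first by apply/cvg_ex; exists (P (\bigcup_N EN N)).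
by apply: nearW => N; exact: PEN.
Qed.

End tail.

(** * Measurability of the estimation error *)

Section bounded_linear.
Context {R : realType} {H : completeNormedModType R}.

Lemma linear_bound_continuous (T : {linear H -> H}) (M : R) :
  (forall x, `|T x| <= M * `|x|) -> continuous T.
Proof.
move=> TM; apply: bounded_linear_continuous; apply/linear_boundedP.
apply: filterS (nbhs_pinfty_ge (num_real M)) => r Mr x.
by apply: le_trans (TM x) _; rewrite ler_wpM2r.
Qed.

Lemma op_norm_le (T : H -> H) (e : R) :
  (forall x, `|x| <= 1 -> `|T x| <= e) -> (op_norm T <= e%:E)%E.
Proof. by move=> h; apply: ge_ereal_sup => _ [x x1 <-]; rewrite lee_fin h. Qed.

(** The points of the open unit ball with [e < |T y|] form an open set. It is nonempty because a
    witness [x] of the closed ball may be shrunk by a factor [s] strictly between [e / |T x|] and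
    1. *)
Lemma op_norm_gt_dense (T : {linear H -> H}) (D : set H) (e : R) :
  continuous T -> dense D -> (e%:E < op_norm T)%E ->
  0 < e -> exists x, [/\ D x, `|x| < 1 & e < `|T x|].
Proof.
move=> Tc Dd /ereal_sup_gt[_ [x x1 <-]]; rewrite lte_fin => eTx e0.
pose O := [set y | `|y| < 1] `&` [set y | e < `|T y|].
have oO : open O.
  apply: openI.
    by apply: (@open_comp _ _ (fun y : H => `|y|) [set r | r < 1]); [move=> y _; exact: norm_continuous|exact: open_lt].
  apply: (@open_comp _ _ (fun y : H => `|T y|) [set r | e < r]); last exact: open_gt.
  by move=> y _; apply: continuous_comp; [exact: Tc|exact: norm_continuous].
have [|y [Oy Dy]] := Dd O _ oO.
  have Tx0 : 0 < `|T x| by exact: lt_trans eTx.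
  pose s := (1 + e / `|T x|) / 2.
  have q1 : e / `|T x| < 1 by rewrite ltr_pdivrMr// mul1r.
  have q0 : 0 < e / `|T x| by rewrite divr_gt0.
  have s0 : 0 < s by rewrite divr_gt0// addr_gt0.
  have s1 : s < 1 by rewrite /s; lra.
  exists (s *: x); split=> /=.
    rewrite normrZ gtr0_norm//; apply: le_lt_trans s1.
    by rewrite -[leRHS]mulr1 ler_wpM2l// ltW.
  rewrite linearZ/= normrZ gtr0_norm// -ltr_pdivrMr//.
  by rewrite /s; lra.
by exists y; case: Oy.
Qed.

End bounded_linear.

(** * Linearity, continuity and trace of the sample operators *)

Section sample_operators.
Context {R : realType} {H : completeNormedModType R} (ip : {dot H for idfun}).
Context {d : measure_display} {Omega : measurableType d}.

Lemma sample_cross_cov_linear (X Y : nat -> Omega -> H) n w :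
  linear (sample_cross_cov ip X Y n w).
Proof.
move=> a x y; rewrite /sample_cross_cov scalerA mulrC -scalerA -scalerDr; congr (_ *: _).
rewrite scaler_sumr -big_split/=; apply: eq_bigr => k _.
by rewrite /tensor ipDr ipZr scalerDl scalerA.
Qed.

HB.instance Definition _ (X Y : nat -> Omega -> H) n w :=
  GRing.isLinear.Build R H H *:%R (sample_cross_cov ip X Y n w)
    (sample_cross_cov_linear X Y n w).

Lemma ip_sample_cross_cov (X Y : nat -> Omega -> H) n w x y :
  ip y (sample_cross_cov ip X Y n w x) =
  n%:R^-1 * \sum_(1 <= k < n.+1) ip x (X k w) * ip y (Y k w).
Proof.
rewrite ipZr ip_sumr; congr (_ * _); apply: eq_bigr => k _.
by rewrite ipZr (ipC ip (X k w)).
Qed.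

Lemma sample_cross_cov_sym (X : nat -> Omega -> H) n w x y :
  ip x (sample_cross_cov ip X X n w y) = ip (sample_cross_cov ip X X n w x) y.
Proof.
rewrite (ipC ip _ y) !ip_sample_cross_cov; congr (_ * _).
by apply: eq_bigr => k _; rewrite mulrC.
Qed.

Hypothesis H_inner : norm_from_inner ip.

Lemma sample_cross_cov_continuous (X Y : nat -> Omega -> H) n w :
  continuous (sample_cross_cov ip X Y n w).
Proof.
apply: (@linear_bound_continuous _ _ _ (n%:R^-1 * \sum_(1 <= k < n.+1) `|X k w| * `|Y k w|)) => x.
rewrite normrZ ger0_norm ?invr_ge0// -mulrA ler_wpM2l ?invr_ge0//.
apply: le_trans (ler_norm_sum _ _ _) _; rewrite mulr_suml; apply: ler_sum => k _.
by rewrite normrZ mulrAC ler_wpM2r// cauchy_schwarz.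
Qed.

Lemma sample_trace_le (X : nat -> Omega -> H) n w (u : nat -> H) J :
  orthonormal_sequence ip u ->
  \sum_(i < J) ip (u i) (sample_cross_cov ip X X n w (u i)) <=
  n%:R^-1 * \sum_(1 <= k < n.+1) `|X k w| ^+ 2.
Proof.
move=> uon; under eq_bigr do rewrite ip_sample_cross_cov.
rewrite -mulr_sumr ler_wpM2l ?invr_ge0// exchange_big/=; apply: ler_sum => k _.
by under eq_bigr do rewrite -expr2; exact: bessel.
Qed.

Lemma sample_eigenvalue_small (X : nat -> Omega -> H) n w lam v :
  eigen_system ip (sample_cross_cov ip X X n w) lam v ->
  forall t, 0 < t -> exists2 j, (0 < j)%N & lam j < t.
Proof.
move=> eig t t0.
pose M := n%:R^-1 * \sum_(1 <= k < n.+1) `|X k w| ^+ 2.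
have tr j : (0 < j)%N -> lam j <= M / j%:R.
  apply: (eigen_trace eig) => J.
  exact: (sample_trace_le X n w J (eigen_on eig)).
exists (Num.truncn (M / t)).+1 => //.
apply: le_lt_trans (tr (Num.truncn (M / t)).+1 isT) _.
by rewrite ltr_pdivrMr// mulrC -ltr_pdivrMr//; exact: truncnS_gt.
Qed.

Lemma Psi_hat_linear lam v (Delta : H -> H) K : linear (Psi_hat ip lam v Delta K).
Proof.
move=> a x y; rewrite /Psi_hat scaler_sumr -big_split/=; apply: eq_bigr => k _.
by rewrite ipDr ipZr mulrDr scalerDl scalerA mulrCA.
Qed.

HB.instance Definition _ lam v (Delta : H -> H) K :=
  GRing.isLinear.Build R H H *:%R (Psi_hat ip lam v Delta K)
    (Psi_hat_linear lam v Delta K).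

Lemma Psi_hat_continuous lam v (Delta : H -> H) K :
  continuous (Psi_hat ip lam v Delta K).
Proof.
apply: (@linear_bound_continuous _ _ _ (\sum_(1 <= j < K.+1) `|(lam j)^-1| * `|v j| * `|Delta (v j)|)) => x.
apply: le_trans (ler_norm_sum _ _ _) _; rewrite mulr_suml; apply: ler_sum => k _.
rewrite normrZ normrM [leRHS]mulrAC ler_wpM2r// -mulrA ler_wpM2l//.
exact: cauchy_schwarz.
Qed.

End sample_operators.

Lemma measurable_sum_pos {R : realType} {d : measure_display}
    {T : measurableType d} (n : nat) (h : nat -> T -> R) :
  (forall k, (0 < k)%N -> measurable_fun setT (h k)) ->
  measurable_fun setT (fun w => \sum_(1 <= k < n.+1) h k w).
Proof.
by move=> mh; under eq_fun do rewrite big_add1; apply: measurable_sum => k; exact: mh.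
Qed.

Section estimator_measurability.
Context {R : realType} {H : completeNormedModType R} (ip : {dot H for idfun}).
Hypothesis H_inner : norm_from_inner ip.
Variable b : nat -> H.
Hypothesis bb : orthonormal_basis ip b.
Context {d : measure_display} {Omega : measurableType d}.

(** Polarization reduces the product of two random elements to norms, which are measurable through
    coordinates. *)
Lemma measurable_ip (Z W : Omega -> H) : random_element Z -> random_element W ->
  measurable_fun setT (fun w => ip (Z w) (W w)).
Proof.
move=> mZ mW.
have mZi i : measurable_fun setT (fun w => ip (b i) (Z w)) by exact: measurable_ip_borel.
have mWi i : measurable_fun setT (fun w => ip (b i) (W w)) by exact: measurable_ip_borel.
have mD : measurable_fun setT (fun w => `|Z w + W w|).
  apply: (measurable_norm_coordinates H_inner bb) => i.
  by under eq_fun do rewrite ipDr; exact: measurable_funD.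
have mB : measurable_fun setT (fun w => `|Z w - W w|) by exact: (measurable_normB_borel H_inner bb).
rewrite (_ : (fun w => _) = (fun w => 4^-1 * (`|Z w + W w| ^+ 2 - `|Z w - W w| ^+ 2))).
  apply: measurable_funM => //; apply: measurable_funB; exact: measurable_funX.
apply/funext => w; rewrite !H_inner ipBl !ipBr ipDl !ipDr (ipC ip (W w) (Z w)).
by field.
Qed.

Variables (X Y : nat -> Omega -> H) (lam : Omega -> nat -> R) (v : Omega -> nat -> H).
Variable n : nat.
Hypothesis mX : forall k, (0 < k)%N -> random_element (X k).
Hypothesis mY : forall k, (0 < k)%N -> random_element (Y k).
Hypothesis mv : forall j, (0 < j)%N -> random_element (fun w => v w j).
Hypothesis eig : forall w, eigen_system ip (sample_cross_cov ip X X n w) (lam w) (v w).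

(** Measurability is assumed of the eigenvectors only. The eigenvalue inherits it as the Rayleigh
    quotient of its unit eigenvector, a finite sum of squares of inner products. *)
Lemma measurable_eigenvalue j : (0 < j)%N -> measurable_fun setT (fun w => lam w j).
Proof.
move=> j0.
rewrite (_ : (fun w => _) = (fun w => n%:R^-1 * \sum_(1 <= k < n.+1)
    ip (v w j) (X k w) * ip (v w j) (X k w))).
  apply: measurable_funM => //; apply: measurable_sum_pos => k k0.
  by apply: measurable_funM; apply: measurable_ip; [exact: mv|exact: mX|exact: mv|exact: mX].
apply/funext => w; rewrite -ip_sample_cross_cov.
by case: (eig w) => _ on -> // _; case: j j0 => // j _; rewrite ipZr (on j j) eqxx mulr1.
Qed.

Lemma measurable_eigengap j : (0 < j)%N -> measurable_fun setT (fun w => eigengap (lam w) j).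
Proof.
move=> j0; rewrite /eigengap; have [j1|j1] := boolP (j == 1%N).
  by apply: measurable_funB; exact: measurable_eigenvalue.
have j1' : (0 < j.-1)%N by case: j j0 j1 => [//|[|]].
by apply: measurable_minr; apply: measurable_funB; exact: measurable_eigenvalue.
Qed.

Variable m : R.
Hypothesis m0 : 0 < m.

Lemma measurable_K_cut_ge j : (0 < j)%N ->
  measurable_fun setT (fun w => (j <= K_cut (lam w) m)%N).
Proof.
move=> j0; apply: (measurable_fun_bool true); rewrite setTI.
have decr w i : (1 <= i)%N -> lam w i.+1 <= lam w i /\ 0 <= lam w i.
  by case: (eig w) => h _ _ _; exact: h.
have KP w := K_cutP (decr w) m0 (sample_eigenvalue_small H_inner (eig w)) j0.
rewrite (_ : _ @^-1` _ = [set w | j%:R <= m /\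
    forall i, (0 < i <= j)%N -> m^-1 <= eigengap (lam w) i]); last first.
  by apply/seteqP; split=> w /= /KP.
have [jm|jm] := boolP (j%:R <= m); last first.
  rewrite (_ : [set w | _] = set0)//.
  by apply/seteqP; split=> // w [].
rewrite (_ : [set w | _] = \bigcap_(i in [set i | (0 < i <= j)%N])
    [set w | m^-1 <= eigengap (lam w) i]); last first.
  apply/seteqP; split=> w /=; first by move=> [_ h] i /= ij; exact: h.
  by move=> h; split=> // i ij; exact: h.
apply: bigcap_measurableType => i /= /andP[i0 _].
have := measurable_eigengap i0 measurableT (measurable_itv `[m^-1, +oo[).
rewrite setTI; congr measurable; apply/seteqP; split=> w /=; by rewrite in_itv/= andbT.
Qed.

(** The number of terms is random but at most [Num.truncn m], so each coordinate is a sum of fixed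
    length whose terms are switched off beyond the cut-off. *)
Lemma measurable_Psi_hat_error (Psi : H -> H) x :
  measurable_fun setT (fun w =>
    `|Psi_hat ip (lam w) (v w) (sample_cross_cov ip X Y n w) (K_cut (lam w) m) x - Psi x|).
Proof.
apply: (measurable_norm_coordinates H_inner bb) => i.
pose a w j := ((lam w j)^-1 * ip (v w j) x) *
  (n%:R^-1 * \sum_(1 <= k < n.+1) ip (v w j) (X k w) * ip (b i) (Y k w)).
have decr w l : (1 <= l)%N -> lam w l.+1 <= lam w l /\ 0 <= lam w l.
  by case: (eig w) => h _ _ _; exact: h.
have Km w : (K_cut (lam w) m <= Num.truncn m)%N.
  case E : (K_cut (lam w) m) => [//|k].
  have := proj1 (K_cutP (decr w) m0 (sample_eigenvalue_small H_inner (eig w)) (ltn0Sn k)).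
  by rewrite E leqnn => /(_ isT) [km _]; rewrite truncn_gt_nat.
rewrite (_ : (fun w => _) = (fun w => \sum_(1 <= j < (Num.truncn m).+1)
    (if (j <= K_cut (lam w) m)%N then a w j else 0) - ip (b i) (Psi x))).
  apply: measurable_funB => //.
  apply: measurable_sum_pos => j j0; apply: measurable_fun_ifT => //; first exact: measurable_K_cut_ge.
  apply: measurable_funM.
    apply: measurable_funM.
      rewrite (_ : (fun w => _) = (fun w => lam w j `^ (-1))); last first.
        by apply/funext => w; rewrite powR_inv1//; case: (decr w j j0).
      by apply: (measurableT_comp (measurable_powR _)); exact: measurable_eigenvalue.
    under eq_fun do rewrite ipC; apply: measurable_ip_borel => //; exact: mv.
  apply: measurable_funM => //; apply: measurable_sum_pos => k k0; apply: measurable_funM.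
    by apply: measurable_ip; [exact: mv|exact: mX].
  by apply: measurable_ip_borel => //; exact: mY.
apply/funext => w; rewrite ipBr; congr (_ - _); rewrite /Psi_hat ip_sumr.
under eq_bigr do rewrite ipZr ip_sample_cross_cov.
rewrite [RHS](@big_cat_nat _ _ _ (K_cut (lam w) m).+1)//= ?ltnS//.
under [X in _ = _ + X]eq_big_nat => j /andP[Kj _] do rewrite leqNgt Kj/=.
rewrite big1_eq addr0; apply: eq_big_nat => j /andP[_ jK].
by rewrite -ltnS jK.
Qed.

(** Strict excess of the supremum is detected at a point of a countable dense set, so the event is a
    countable union. Measurability is what allows its probability to be compared with those of the
    bad events. *)
Lemma measurable_op_norm_error (Psi : {linear H -> H}) (e : R) : continuous Psi ->
  separable H -> 0 < e ->
  measurable [set w | (e%:E < op_norm (fun x =>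
    Psi_hat ip (lam w) (v w) (sample_cross_cov ip X Y n w) (K_cut (lam w) m) x
    - Psi x)%R)%E].
Proof.
move=> Psic [D Dc Dd] e0.
have [g Dg] : exists g : nat -> H, set_surj setT D g by exact/pcard_surjP.
pose T w x := Psi_hat ip (lam w) (v w) (sample_cross_cov ip X Y n w) (K_cut (lam w) m) x - Psi x.
rewrite (_ : [set w | _] = \bigcup_(k in [set k | `|g k| <= 1]) [set w | e < `|T w (g k)|]).
  apply: bigcup_measurable => k _.
  have := measurable_Psi_hat_error Psi (g k) measurableT (measurable_itv `]e, +oo[).
  by rewrite setTI; congr measurable; apply/seteqP; split=> w /=; rewrite in_itv/= andbT.
apply/seteqP; split=> w /=.
  pose L : {linear H -> H} := Psi_hat ip (lam w) (v w) (sample_cross_cov ip X Y n w) (K_cut (lam w) m) \- Psi.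
  have Lc : continuous L.
    move=> x; apply: cvgB; [exact: Psi_hat_continuous|exact: Psic].
  move=> /(@op_norm_gt_dense _ _ L D e Lc Dd) /(_ e0) [x [Dx x1 ex]].
  have [k _ kx] := Dg _ Dx.
  by exists k => /=; rewrite kx ?ltW.
move=> [k /= k1 ek]; apply: (@lt_le_trans _ _ (`|T w (g k)|)%:E); first by rewrite lte_fin.
by apply: ereal_sup_ubound; exists (g k).
Qed.

End estimator_measurability.

(** * Covariance operators *)

Section covariance.
Context {R : realType} {H : completeNormedModType R} (ip : {dot H for idfun}).
Hypothesis H_inner : norm_from_inner ip.
Context {d : measure_display} {Omega : measurableType d}.
Variable P : probability Omega R.

Lemma is_mean_integral (Z : Omega -> H) mu u : is_mean P ip Z mu ->
  P.-integrable setT (fun w => (ip u (Z w))%:E) /\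
  (\int[P]_w (ip u (Z w))%:E = (ip u mu)%:E)%E.
Proof.
move=> [mZ Zfin Zmu]; split; last by have := Zmu u; rewrite unlock.
have iZ : P.-integrable setT (fun w => (`|Z w|)%:E).
  apply/integrableP; split; first by apply/measurable_EFinP; exact: measurable_norm_borel.
  by move: Zfin; rewrite unlock; under [in X in _ -> X]eq_integral do rewrite abse_EFin normr_id.
apply: (le_integrable measurableT _ _ (integrableM_EFin `|u| iZ)) => //.
  by apply/measurable_EFinP; exact: measurable_ip_borel.
move=> w _; rewrite !abse_EFin lee_fin [leRHS]ger0_norm ?mulr_ge0//.
exact: cauchy_schwarz.
Qed.

Lemma cross_cov_integral (Z W : Omega -> H) T u v : is_cross_cov P ip Z W T ->
  P.-integrable setT (fun w => (ip v (Z w) * ip u (W w))%:E) /\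
  (\int[P]_w (ip v (Z w) * ip u (W w))%:E = (ip u (T v))%:E)%E.
Proof.
move=> /(_ v) /(@is_mean_integral _ _ u).
by under eq_fun do rewrite /tensor ipZr (ipC ip (Z _) v).
Qed.

Lemma cross_cov_centered (Z W : Omega -> H) T u v : is_cross_cov P ip Z W T ->
  (\int[P]_w (ip v (Z w) * ip u (W w) - ip u (T v))%:E = 0)%E.
Proof.
move=> /(@cross_cov_integral _ _ _ u v)[i e].
under eq_integral do rewrite EFinB.
rewrite integralB//=; last exact: finite_measure_integrable_cst.
by rewrite e integral_cst//= probability_setT mule1 -EFinB subrr.
Qed.

Lemma ip_inj x y : (forall u, ip u x = ip u y) -> x = y.
Proof.
move=> h; apply/eqP; rewrite -subr_eq0 -normr_eq0 -sqrf_eq0 H_inner.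
by rewrite ipBr h subrr.
Qed.

(** A cross covariance is given only as a function specified by weak integrals. Its linearity
    follows because those integrals determine every inner product with [T v]. *)
Lemma cross_cov_linear (Z W : Omega -> H) T : is_cross_cov P ip Z W T -> linear T.
Proof.
move=> h a x y; apply: ip_inj => u; apply: EFin_inj.
have [ix ex] := cross_cov_integral u x h; have [iy ey] := cross_cov_integral u y h.
have [_ <-] := cross_cov_integral u (a *: x + y) h.
under eq_integral do rewrite ipDl ipZl mulrDl -mulrA EFinD EFinM.
rewrite integralD//=; last exact: integrableM_EFin.
by rewrite integralZl// ex ey ipDr ipZr.
Qed.

Lemma L4_sqr_integrable (Z : Omega -> H) : in_LpH P 4 Z ->
  P.-integrable setT (fun w => (`|Z w| ^+ 2)%:E).
Proof.
move=> [mZ Zfin].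
have mn : measurable_fun setT (fun w => `|Z w|) by exact: measurable_norm_borel.
have fin : nu P 4 Z \is a fin_num by rewrite ge0_fin_numE// Lnorm_ge0.
have i4 : P.-integrable setT (fun w => (`|Z w| ^+ 4)%:E).
  apply/integrableP; split; first by apply/measurable_EFinP; exact: measurable_funX.
  under eq_integral do rewrite gee0_abs ?lee_fin//.
  apply: (@le_lt_trans _ _ (fine (nu P 4 Z) ^+ 4)%:E); last exact: ltry.
  by apply: nu4_le; rewrite ?fineK// fine_ge0// Lnorm_ge0.
have i1 : P.-integrable setT (fun _ : Omega => (1 : R)%:E) by exact: finite_measure_integrable_cst.
apply: (le_integrable measurableT _ _ (integrableD_EFin i1 i4)) => //.
  by apply/measurable_EFinP; exact: measurable_funX.
move=> w _; rewrite !abse_EFin lee_fin !ger0_norm ?addr_ge0//.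
move: `|Z w| => t; have := sqr_ge0 (t ^+ 2 - 1); nra.
Qed.

(** One constant, the second moment of [|Z w|], serves twice: Bessel under the integral bounds the
    traces, and testing [C x] against itself gives |C x|^2 <= M |x| |C x|. *)
Lemma cov_trace_bound (Z : Omega -> H) C : in_LpH P 4 Z -> is_cross_cov P ip Z Z C ->
  exists2 M, forall u, orthonormal_sequence ip u ->
      forall J, \sum_(i < J) ip (u i) (C (u i)) <= M &
    forall x, `|C x| <= M * `|x|.
Proof.
move=> ZL h; have iZ := L4_sqr_integrable ZL; have [mZ _] := ZL.
have mn : measurable_fun setT (fun w => `|Z w|) by exact: measurable_norm_borel.
have mi x : measurable_fun setT (fun w => ip x (Z w)) by exact: measurable_ip_borel.
pose M := fine (\int[P]_w (`|Z w| ^+ 2)%:E).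
have ME : (M%:E = \int[P]_w (`|Z w| ^+ 2)%:E)%E.
  by rewrite fineK//; exact: integrable_fin_num.
exists M.
  move=> u uon J; rewrite -lee_fin ME -sumEFin.
  rewrite (eq_bigr (fun i : 'I_J => \int[P]_w (ip (u i) (Z w) ^+ 2)%:E)%E); last first.
    move=> i _; have [_ <-] := cross_cov_integral (u i) (u i) h.
    by under eq_integral do rewrite -expr2.
  rewrite -ge0_integral_sum_EFin; last 2 first.
  - by move=> i; exact: measurable_funX.
  - by move=> i w; exact: sqr_ge0.
  apply: ge0_le_integral_EFin.
  - by apply: measurable_sum => i; exact: measurable_funX.
  - exact: measurable_funX.
  - by move=> w; apply: sumr_ge0 => i _; exact: sqr_ge0.
  - by move=> w; exact: bessel.
move=> x.
have [->|Cx0] := eqVneq (C x) 0.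
  by rewrite normr0 mulr_ge0// -lee_fin ME; apply: integral_ge0 => w _; rewrite lee_fin.
have Cx : 0 < `|C x| by rewrite normr_gt0.
rewrite -(ler_pM2l Cx) -expr2 H_inner -lee_fin.
have [i <-] := cross_cov_integral (C x) x h.
apply: (@le_trans _ _ (\int[P]_w ((`|C x| * `|x|) * `|Z w| ^+ 2)%:E)%E).
  apply: le_integral => //; first exact: integrableM_EFin.
  move=> w _; rewrite lee_fin; apply: le_trans (ler_norm _) _; rewrite normrM.
  rewrite [leRHS](_ : _ = (`|x| * `|Z w|) * (`|C x| * `|Z w|)); last by ring.
  by apply: ler_pM => //; exact: cauchy_schwarz.
rewrite ge0_integralM_EFin ?mulr_ge0//; last exact: measurable_funX.
by rewrite -ME -EFinM lee_fin mulrAC mulrA.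
Qed.

Variable b : nat -> H.
Hypothesis bb : orthonormal_basis ip b.

(** For fixed [N], the inner range is enlarged to [M] and Parseval gives the limit; each N-by-M
    block lies in the M-by-M square, to which the hypothesis applies. *)
Lemma hs_of_coordinates (T : {linear H -> H}) h :
  (forall N, \sum_(i < N) \sum_(j < N) ip (b j) (T (b i)) ^+ 2 <= h ^+ 2) ->
  forall N, \sum_(i < N) `|T (b i)| ^+ 2 <= h ^+ 2.
Proof.
move=> hT N.
have c1 : \sum_(i < N) \sum_(j < M) ip (b j) (T (b i)) ^+ 2 @[M --> \oo] -->
    \sum_(i < N) `|T (b i)| ^+ 2.
  elim: N => [|N IH].
    by rewrite big_ord0; under eq_fun do rewrite big_ord0; exact: cvg_cst.
  rewrite big_ord_recr/=; under eq_fun do rewrite big_ord_recr/=.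
  by apply: cvgD => //; exact: (parseval H_inner).
have c2 : (fun=> h ^+ 2) @ \oo --> h ^+ 2 by exact: cvg_cst.
apply: (ler_cvg_to c1 c2); exists N => //= M NM.
apply: le_trans (hT M).
rewrite -!(big_mkord xpredT (fun i => \sum_(j < M) ip (b j) (T (b i)) ^+ 2)).
rewrite [leRHS](@big_cat_nat _ _ _ N)//= lerDl.
by apply: sumr_ge0 => i _; apply: sumr_ge0 => j _; exact: sqr_ge0.
Qed.

(** [T] and [C] are left free so as to cover both Chat - C and the residual R_n, the latter with the
    zero operator as mean. *)
Lemma sample_deviation_bound (X W : nat -> Omega -> H) n w (T C : {linear H -> H}) h :
  (0 < n)%N -> 0 <= h -> continuous T ->
  (forall x, T x = sample_cross_cov ip X W n w x - C x) ->
  (forall N, \sum_(i < N) \sum_(j < N) (\sum_(1 <= k < n.+1)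
     (ip (b i) (X k w) * ip (b j) (W k w) - ip (b j) (C (b i)))) ^+ 2 <= (n%:R * h) ^+ 2) ->
  forall x, `|T x| <= h * `|x|.
Proof.
move=> n0 h0 Tc TE hT x; apply: (hs_bound H_inner bb) => //.
have nr0 : 0 < n%:R :> R by rewrite ltr0n.
apply: hs_of_coordinates => N.
rewrite -(ler_pM2l (exprn_gt0 2 nr0)) -exprMn; apply: le_trans (hT N).
rewrite le_eqVlt; apply/orP; left; apply/eqP.
rewrite mulr_sumr; apply: eq_bigr => i _; rewrite mulr_sumr; apply: eq_bigr => j _.
rewrite -exprMn; congr (_ ^+ 2).
rewrite TE ipBr ip_sample_cross_cov sumrB sumr_const_nat subn1/= mulrBr mulrA mulfV ?gt_eqF//.
by rewrite mul1r mulr_natl.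
Qed.

End covariance.

(** * Consistency *)

Section consistency.
Context {R : realType}.

Lemma cvge0_of_dominated (p : nat -> \bar R) (B : R) (m : nat -> R) :
  (fun n => m n ^+ 6 : R) =o_\oo (fun n => n%:R : R) ->
  (\forall n \near \oo, (0 <= p n <= (B * (m n ^+ 6 / n%:R))%:E)%E) ->
  p n @[n --> \oo] --> 0%E.
Proof.
move=> /eqoP mo pn.
have c0 : (fun n => m n ^+ 6 / n%:R : R) @ \oo --> (0 : R).
  apply/cvgrPdist_le => e e0; have := mo e e0.
  move=> h; near=> n; rewrite sub0r normrN.
  have n0 : (0 < n)%N by near: n; exists 1%N.
  have nr0 : 0 < n%:R :> R by rewrite ltr0n.
  rewrite normrM normfV (gtr0_norm nr0) ler_pdivrMr//.
  by rewrite -[X in _ * X](gtr0_norm nr0); near: n.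
apply: (@squeeze_cvge _ _ _ _ (fun=> 0%E) p (fun n => (B * (m n ^+ 6 / n%:R))%:E)) => //.
  exact: cvg_cst.
apply: cvg_EFin; first exact: nearW.
rewrite [X in _ --> X](_ : _ = B * 0); last by rewrite mulr0.
by apply: cvgM => //; exact: cvg_cst.
Unshelve. all: by end_near. Qed.

End consistency.

Unset Implicit Arguments.

Theorem corollary2 (R : realType)
    (d : measure_display) (Omega : measurableType d) (P : probability Omega R)
    (H : completeNormedModType R) (ip : {dot H for idfun})
    (H_inner : norm_from_inner ip)
    (H_separable : separable H)
    (H_infinite : infinite_dimensional H)
    (Psi : {linear H -> H}) (Psi_bounded : continuous Psi)
    (b : nat -> H) (b_basis : orthonormal_basis ip b)
    (Psi_HS : (HS_norm b Psi < 1)%E)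
    (X : nat -> Omega -> H) (eps : int -> Omega -> H)
    (X_ARH1 : ARH1 P Psi X eps)
    (C : H -> H) (C_cov : is_cross_cov P ip (X 1%N) (X 1%N) C)
    (C_distinct : distinct_eigenvalues ip C)
    (C_dense : closure (range C) = [set: H])
    (eps_noise : white_noise P ip [set: int] eps)
    (model_A : assumption_A P ip Psi X (fun k => X k.+1)
                 (fun k => eps k.+1%:Z))
    (lamhat : nat -> Omega -> nat -> R) (vhat : nat -> Omega -> nat -> H)
    (vhat_random : forall n j, (1 <= n)%N -> (1 <= j)%N ->
       random_element (fun w => vhat n w j))
    (hat_eigen : forall n w, (1 <= n)%N ->
       eigen_system ip (sample_cross_cov ip X X n w) (lamhat n w) (vhat n w))
    (m : nat -> R) (m_infty : m n @[n --> \oo] --> +oo)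
    (m_rate : (fun n => m n ^+ 6 : R) =o_\oo (fun n => n%:R : R)) :
  cvg0_in_probability P (fun n w =>
    op_norm (fun x =>
      Psi_hat ip (lamhat n w) (vhat n w)
        (sample_cross_cov ip X (fun k => X k.+1) n w)
        (K_cut (lamhat n w) (m n)) x
      - Psi x)).
Proof.
have [_ _ _ [d' [S [delta [delta' [f [g [iidd copy aX ae]]]]]]] [_ orth]] := model_A.
have [_ recur _ _ _] := model_A.
have [_ XL _ _] := aX; have [_ eL _ _] := ae.
have mX k : (0 < k)%N -> random_element (X k) by move=> /XL[].
have mX' k : (0 < k)%N -> random_element (X k.+1) by move=> _; exact: mX.
pose CL : {linear H -> H} := HB.pack C
  (GRing.isLinear.Build R H H *:%R C (cross_cov_linear H_inner C_cov)).
have [M CM CMle] := cov_trace_bound H_inner (XL 1%N isT) C_cov.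
have CLc : continuous CL by exact: (linear_bound_continuous (T := CL) CMle).
have [B0 PsiB] : exists B, forall N, \sum_(i < N) `|Psi (b i)| ^+ 2 <= B.
  by apply: HS_norm_bound; apply: lt_trans Psi_HS _; rewrite ltry.
have [A1 A10 tail1] := tensor_tail_bound H_inner b_basis iidd copy aX aX
  (fun i j => cross_cov_centered H_inner (b j) (b i) C_cov).
(* Orthogonality of X_k and e_k enters here: it makes the centering constants of the second family
   zero. *)
have [A2 A20 tail2] := tensor_tail_bound H_inner b_basis iidd copy aX ae
  (fun i j => cross_cov_centered H_inner (b j) (b i) (orth 1%N isT)).
(* A single null set, outside which the recursion holds for all times simultaneously. *)
have [NX [mNX NX0 NXP]] : {ae P, forall w, forall k, (0 < k)%N ->
    X k.+1 w = Psi (X k w) + eps k.+1%:Z w}.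
  by apply: ae_foralln => -[|k]; [exact: aeW|apply: filterS (recur k.+1 isT)].
move=> e e0.
have [dd [m0 [dd0 m00 bound]]] := estimator_error_bound H_inner b_basis
  Psi_bounded CLc PsiB C_dense C_distinct CM e0.
apply: (@cvge0_of_dominated _ _ ((A1 + A2) / dd ^+ 2) m m_rate).
near=> n.
have n0 : (0 < n)%N by near: n; exists 1%N.
have nr0 : 0 < n%:R :> R by rewrite ltr0n.
(* The bound [1 <= m n] lets the powers 0 and 2 of [m n] in the two tail bounds be absorbed by the
   power 6. *)
have m0n : Num.max m0 1 <= m n.
  near: n; by move/cvgryPge : m_infty; exact.
have m0mn : m0 <= m n by apply: le_trans m0n; rewrite le_max lexx.
have m1mn : 1 <= m n by apply: le_trans m0n; rewrite le_max lexx orbT.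
have mn0 : 0 < m n by exact: lt_le_trans m1mn.
have dm0 : 0 < dd / m n by rewrite divr_gt0.
(* The threshold is [dd] for the covariance and [dd / m n] for the residual, since the latter is
   multiplied by up to [m n] in the error. This factor, squared by Markov, accounts for
   [m n ^+ 2]. *)
have [mE1 PE1] := tail1 n dd n0 dd0.
have [mE2 PE2] := tail2 n (dd / m n) n0 dm0.
have mE := measurable_op_norm_error H_inner b_basis mX mX'
  (fun j j0 => vhat_random n j n0 j0) (fun w => hat_eigen n w n0) mn0
  Psi_bounded H_separable e0.
rewrite measure_ge0/=.
set E1 := [set w | _] in mE1 PE1; set E2 := [set w | _] in mE2 PE2.
apply: (@le_trans _ _ (P (E1 `|` E2 `|` NX))).
  apply: le_measure; rewrite ?inE//; first by apply: measurableU => //; exact: measurableU.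
  (* Outside the two tail events and the null set, the deterministic bound applies to the sample
     operators at [w]. *)
  move=> w ew; apply: contrapT => nw; apply/negP: ew; rewrite -leNgt.
  have [nE1 nE2 nNX] : [/\ ~ E1 w, ~ E2 w & ~ NX w].
    by split=> h; apply: nw; [left; left|left; right|right].
  have rw k : (0 < k)%N -> X k.+1 w = Psi (X k w) + eps k.+1%:Z w.
    by move=> k0; apply: contrapT => h; apply: nNX; apply: NXP => /(_ k k0).
  apply: op_norm_le.
  pose Chat : {linear H -> H} := sample_cross_cov ip X X n w.
  pose Rn : {linear H -> H} := sample_cross_cov ip X (fun k => eps k.+1%:Z) n w.
  pose Dn : {linear H -> H} := sample_cross_cov ip X (fun k => X k.+1) n w.
  have cont Y : continuous (sample_cross_cov ip X Y n w) by exact: sample_cross_cov_continuous.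
  apply: (bound Chat Rn Dn _ _ _ (dd / m n)) => //.
  - exact: cont.
  - exact: sample_cross_cov_sym.
  - exact: hat_eigen.
  - by have h := sample_eigenvalue_small H_inner (hat_eigen n w n0); exact: h.
  - move=> x; rewrite distrC.
    pose T : {linear H -> H} := Chat \- CL.
    apply: (sample_deviation_bound H_inner b_basis (X := X) (W := X) (w := w)
      (T := T) (C := CL) n0 (ltW dd0)) => //.
      by move=> y; apply: cvgB; [exact: cont|exact: CLc].
    by move=> N; rewrite leNgt; apply/negP => h; apply: nE1; exists N.
  - move=> x.
    pose Z : {linear H -> H} := \0.
    apply: (sample_deviation_bound H_inner b_basis (X := X)
      (W := fun k => eps k.+1%:Z) (w := w) (T := Rn) (C := Z) n0 (ltW dm0)) => //.
    + exact: cont.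
    + by move=> y; rewrite subr0.
    by move=> N; rewrite leNgt; apply/negP => h; apply: nE2; exists N.
  - exact: ltW.
  - by rewrite divfK// gt_eqF.
  - move=> y; rewrite /Dn /Rn /Chat /sample_cross_cov linearZ/= -scalerDr; congr (_ *: _).
    rewrite linear_sum -big_split/=; apply: eq_big_nat => k /andP[k0 _].
    by rewrite /tensor rw// scalerDr linearZ.
apply: (@le_trans _ _ (P E1 + P E2 + P NX)%E).
  apply: le_trans (measureU2 _ _ _) _ => //; first exact: measurableU.
  by rewrite leeD2r// measureU2.
rewrite NX0 adde0; apply: le_trans (leeD PE1 PE2) _.
rewrite -EFinD lee_fin.
have m26 k : (k <= 6)%N -> m n ^+ k <= m n ^+ 6 by move=> k6; rewrite ler_weXn2l.
rewrite [leLHS](_ : _ = (A1 * m n ^+ 0 + A2 * m n ^+ 2) / (n%:R * dd ^+ 2)); last first.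
  by field; rewrite !gt_eqF.
rewrite [leRHS](_ : _ = ((A1 + A2) * m n ^+ 6) / (n%:R * dd ^+ 2)); last first.
  by field; rewrite !gt_eqF.
have nd0 : 0 <= (n%:R * dd ^+ 2)^-1 by rewrite invr_ge0 mulr_ge0 ?sqr_ge0.
apply: ler_wpM2r => //; rewrite [leRHS]mulrDl.
by apply: lerD; apply: ler_wpM2l => //; exact: m26.
Unshelve. all: by end_near. Qed.
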